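(* There is no Polish space $Y$ and Borel function $g\colon \mathcal V^2(T^2)\to Y$ such that for all $v,w\in\mathcal V^2(T^2)$ one has $v\sim w$ if and only if $g(v)=g(w)$. Here $\sim$ denotes orbital topological equivalence. In other words, orbital topological equivalence in $\mathcal V^2(T^2)$ has no complete Borel numerical invariant.
   Context: $T^2=\mathbb R^2/\mathbb Z^2$ is the two-torus and $\mathcal V^2(T^2)$ is the space of $C^2$-smooth vector fields on $T^2$, with the $C^2$ topology. Two vector fields $v,w\in\mathcal V^2(T^2)$ are orbitally topologically equivalent, written $v\sim w$, if there exists a homeomorphism $H\colon T^2\to T^2$, homotopic to the identity, that takes orbits of $v$ to orbits of $w$, preserving time orientation. A topological space is Polish if it is separable and completely metrizable. A map between topological spaces is Borel if preimages of open sets are Borel sets. *)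

(* Defs.v *)
From HB Require Import structures.
From mathcomp Require Import all_boot all_order all_algebra generic_quotient.
From mathcomp Require Import all_classical all_reals all_analysis.

Set Implicit Arguments.
Unset Strict Implicit.
Unset Printing Implicit Defensive.

Import Order.TTheory GRing.Theory Num.Theory.
Import numFieldNormedType.Exports.

Local Open Scope classical_set_scope.
Local Open Scope ring_scope.
Local Open Scope quotient_scope.

Section Torus.
Context (R : realType).

Definition lattice_rel : rel (R * R) :=
  fun x y => (x.1 - y.1 \is a Num.int) && (x.2 - y.2 \is a Num.int).

Lemma lattice_rel_refl : reflexive lattice_rel.
Proof. by move=> x; rewrite /lattice_rel !subrr !rpred0. Qed.

Lemma lattice_rel_sym : symmetric lattice_rel.
Proof.
by move=> x y; rewrite /lattice_rel -[x.1 - _]opprB -[x.2 - _]opprB !rpredN.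
Qed.

Lemma lattice_rel_trans : transitive lattice_rel.
Proof.
move=> y x z /andP[xy1 xy2] /andP[yz1 yz2]; rewrite /lattice_rel.
by rewrite -(subrKA y.1 x.1) -(subrKA y.2 x.2); apply/andP; split; apply: rpredD.
Qed.

Canonical lattice_equiv :=
  EquivRel lattice_rel lattice_rel_refl lattice_rel_sym lattice_rel_trans.

Definition torus := quotient_topology {eq_quot lattice_equiv}.

Definition torus_proj (x : R * R) : torus := \pi_torus x.

(* C^k maps of the plane, through continuity of iterated partial derivatives. *)
Fixpoint smooth_class (k : nat) (f : R * R -> R * R) : Prop :=
  continuous f /\
  if k is k'.+1 then
    [/\ forall x, derivable f x (1, 0), forall x, derivable f x (0, 1),
        smooth_class k' ('D_(1, 0) f) & smooth_class k' ('D_(0, 1) f)]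
  else True.

(* The tangent bundle of the torus is trivialized by the coordinate fields, so
   a vector field is a function torus -> R * R; its regularity is that of its
   lift to the plane. *)
Record vfield := VField {
  vfield_fun :> torus -> R * R;
  vfield_C2 : smooth_class 2 (vfield_fun \o torus_proj) }.

HB.instance Definition _ := gen_eqMixin vfield.
HB.instance Definition _ := gen_choiceMixin vfield.

(* All partial derivatives of order at most 2 of the lift of v. *)
Definition jet2 (v : vfield) : {uniform R * R ->
    (R * R) * ((R * R) * (R * R)) *
    ((R * R) * (R * R) * ((R * R) * (R * R)))} :=
  let f : R * R -> R * R := v \o torus_proj in
  let f1 := 'D_(1, 0) f in
  let f2 := 'D_(0, 1) f in
  fun x => (f x, (f1 x, f2 x),
            ('D_(1, 0) f1 x, 'D_(0, 1) f1 x, ('D_(1, 0) f2 x, 'D_(0, 1) f2 x))).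

(* The C^2 topology: uniform convergence of all partial derivatives of order
   at most 2. *)
HB.instance Definition _ :=
  Topological.copy vfield (initial_topology jet2).

(* The derivative of a curve in the torus is that of any of its lifts. *)
Definition integral_curve (v : vfield) (c : R -> torus) : Prop :=
  exists2 x : R -> R * R, c = torus_proj \o x &
    forall t : R, is_derive t 1 x (v (c t)).

Definition homeomorphism (X Y : topologicalType) (f : X -> Y) : Prop :=
  continuous f /\
  exists g : Y -> X, [/\ continuous g, cancel f g & cancel g f].

Definition homotopic (X Y : topologicalType) (f g : X -> Y) : Prop :=
  exists h : R * X -> Y,
    [/\ {within `[0, 1] `*` setT, continuous h},
        forall x, h (0, x) = f x & forall x, h (1, x) = g x].

(* Integral curves are defined on all of R, so the orbit of a point is the
   image of the integral curve through it, oriented by time. As tau is onto,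
   the image under H of an orbit of v is a whole orbit of w; as H is bijective
   and orbits partition the torus, every orbit of w is obtained. At a zero of v
   the condition says that its image is a zero of w. *)
Definition maps_oriented_orbits (H : torus -> torus) (v w : vfield) : Prop :=
  forall c, integral_curve v c ->
    exists (d : R -> torus) (tau : R -> R),
      [/\ integral_curve w d, {homo tau : s t / s < t}, bijective tau &
          forall t, H (c t) = d (tau t)].

Definition orbitally_equivalent (v w : vfield) : Prop :=
  exists H : torus -> torus,
    [/\ homeomorphism H, homotopic H id & maps_oriented_orbits H v w].

Definition separable (Y : topologicalType) : Prop :=
  exists2 D : set Y, countable D & dense D.

Definition completely_metrizable (Y : topologicalType) : Prop :=
  exists d : Y -> Y -> R,
    [/\ forall x y, d x y = 0 <-> x = y,
        forall x y, d x y = d y x,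
        forall x y z, d x z <= d x y + d y z,
        forall x (A : set Y),
          nbhs x A <-> exists2 e : R, 0 < e & [set y | d x y < e] `<=` A &
        forall u : nat -> Y,
          (forall e : R, 0 < e ->
             exists N : nat, forall m n, (N <= m)%N -> (N <= n)%N ->
               d (u m) (u n) < e) ->
          exists l : Y, u @ \oo --> l].

Definition polish (Y : topologicalType) : Prop :=
  separable Y /\ completely_metrizable Y.

End Torus.

Definition borel (X : topologicalType) : set_system X := <<s @open X >>.

Definition borel_function (X Y : topologicalType) (g : X -> Y) : Prop :=
  forall U : set Y, open U -> @borel X (g @^-1` U).

(* Main.v *)
Require Import Defs.
From HB Require Import structures.
From mathcomp Require Import all_boot all_order all_algebra generic_quotient.
From mathcomp Require Import all_classical all_reals all_analysis.
From mathcomp Require Import zify ring lra.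

(** Equivalence classes are separated by a bi-infinite sequence of bits which a
    topological equivalence sees only up to translation, and no Borel map into
    a Polish space can tell such classes apart.

    A sequence e : int -> bool is coded by a horizontal field (speed e y, 0).
    For every e the rest points are the same: the circles where tan (pi y) is
    an integer n, and the polar circle y = 1/2, at which they accumulate from
    both sides.  The bit e n is the direction of rotation on the annulus
    n < tan (pi y) < n + 1.  The speed is a fixed nonnegative function times a
    sign; the function and its first two derivatives vanish at the rest
    circles, so the signs can be chosen freely without losing smoothness, and
    altering far away bits is a small perturbation in the C^2 topology
    (coded_field_continuous).

    Translating e by one gives an equivalent field: the homeomorphism of the
    vertical circle conjugate to t |-> t + 1 under t = tan (pi y) is isotopic
    to the identity and carries each horizontal orbit to a horizontal orbit
    (translate_equivalent).

    Conversely (rigidity), suppose H carries the orbits of the field of e to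
    those of the field of e'.  A periodic orbit goes to a periodic orbit, so H
    maps horizontal circles to horizontal circles, first off the rest circles
    and then, by density, everywhere.  The polar circle is the only limit of
    rest circles, so H preserves it (level_map_pole) and acts on the remaining
    heights as a homeomorphism F of the line with F^-1(Z) = Z; hence F moves
    the annulus n to the annulus k + n or k - n (inj_int_map).  The sense in
    which H maps a horizontal circle is locally constant, hence the same for
    all circles.  So e is obtained from e' by translation, reflection and
    global negation, and each class contains only countably many codes.

    If g were a Borel invariant, e |-> g (field of e) would be a translation
    invariant map on {0,1}^Z under which preimages of open sets have the Baire
    property.  By the topological zero-one law (zero_one) it is constant on a
    comeager set (generic_constant).  All codes in that set would then be
    equivalent, although the set is uncountable (baire). *)

Set Implicit Arguments.
Unset Strict Implicit.
Unset Printing Implicit Defensive.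

Import Order.TTheory GRing.Theory Num.Theory.
Import numFieldNormedType.Exports.

Local Open Scope classical_set_scope.

(** * Baire category on bi-infinite sequences of bits *)

(** Agreement on a window around the origin: the relations agree N a _ describe
    the basic neighbourhoods of a in the product topology. *)
Definition agree (N : nat) (a b : int -> bool) : Prop :=
  forall n : int, `|n| <= N -> a n = b n.

Lemma agree_sym N a b : agree N a b -> agree N b a.
Proof. by move=> ab n nN; rewrite ab. Qed.

Lemma agree_trans N a b c : agree N a b -> agree N b c -> agree N a c.
Proof. by move=> ab bc n nN; rewrite ab// bc. Qed.

Lemma agree_le N M a b : N <= M -> agree M a b -> agree N a b.
Proof. by move=> NM ab n nN; apply: ab; apply: leq_trans NM. Qed.

Definition nowhere_dense (D : set (int -> bool)) : Prop :=
  forall a N, exists b M, [/\ N <= M, agree N a b &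
    forall c, agree M b c -> ~ D c].

Definition meager (A : set (int -> bool)) : Prop :=
  exists D : nat -> set (int -> bool),
    (forall n, nowhere_dense (D n)) /\ A `<=` \bigcup_n D n.

Lemma meager_sub A B : A `<=` B -> meager B -> meager A.
Proof. by move=> AB [D [Dn BD]]; exists D; split => //; apply: subset_trans BD. Qed.

Lemma nowhere_dense_meager D : nowhere_dense D -> meager D.
Proof. by move=> Dn; exists (fun=> D); split => // x Dx; exists 0. Qed.

Lemma nowhere_dense0 : nowhere_dense set0.
Proof. by move=> a N; exists a, N; split => // c _ []. Qed.

Lemma meager_bigcup (I : countType) (A : I -> set (int -> bool)) :
  (forall i, meager (A i)) -> meager (\bigcup_i A i).
Proof.
move=> /choice[D DA].
exists (fun k => if unpickle k is Some (i, n) then D i n else set0).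
split=> [k|x [i _ Aix]].
  by case: unpickle => [[i n]|]; [exact: (DA i).1|exact: nowhere_dense0].
have [n _ Dx] := (DA i).2 _ Aix.
by exists (pickle (i, n)) => //; rewrite pickleK.
Qed.

Lemma meagerU A B : meager A -> meager B -> meager (A `|` B).
Proof.
move=> mA mB; have : meager (\bigcup_(b : bool) if b then A else B).
  by apply: meager_bigcup => -[].
by apply: meager_sub => x [Ax|Bx]; [exists true|exists false].
Qed.

Lemma meager1 a : meager [set a].
Proof.
apply: nowhere_dense_meager => b N.
(* disagree with a at the first place outside of the window of b *)
exists (fun n => if `|n| <= N then b n else ~~ a n), N.+1; split=> //.
  by move=> n ->.
move=> c /(_ (Posz N.+1)); rewrite absz_nat leqnn ltnn => /(_ isT) + ca.
by rewrite ca; case: (a _).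
Qed.

(** The Baire category theorem: shrinking windows that avoid one nowhere dense
    set after the other have a common point. *)
Theorem baire A a N : meager A -> exists2 b, agree N a b & ~ A b.
Proof.
move=> [D [Dn AD]].
have [f fP] : exists f : nat -> (int -> bool) * nat -> (int -> bool) * nat,
    forall k p, [/\ p.2 < (f k p).2, agree p.2 p.1 (f k p).1 &
      forall c, agree (f k p).2 (f k p).1 c -> ~ D k c].
  suff /choice[f fP] : forall k, exists g : (int -> bool) * nat ->
      (int -> bool) * nat, forall p, [/\ p.2 < (g p).2,
      agree p.2 p.1 (g p).1 & forall c, agree (g p).2 (g p).1 c -> ~ D k c].
    by exists f.
  move=> k; suff /choice[g gP] : forall p : (int -> bool) * nat,
      exists q : (int -> bool) * nat, [/\ p.2 < q.2,
      agree p.2 p.1 q.1 & forall c, agree q.2 q.1 c -> ~ D k c] by exists g.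
  move=> p.
  have [b [M [pM pb bD]]] := Dn k p.1 p.2.
  by exists (b, M.+1); split => //= c Mc; apply: bD; apply: agree_le Mc.
pose p := fix p k := if k is k'.+1 then f k' (p k') else (a, N).
have pk k : k <= (p k).2.
  by elim: k => //= k IH; case: (fP k (p k)) => + _ _; apply: leq_ltn_trans.
have agp j k : agree (p j).2 (p j).1 (p (j + k)).1.
  have step i : agree (p i).2 (p i).1 (p i.+1).1 by case: (fP i (p i)).
  have mono i : (p i).2 <= (p i.+1).2 by case: (fP i (p i)) => /ltnW.
  elim: k => [|k IH]; first by rewrite addn0.
  rewrite addnS; apply: (agree_trans IH); apply: agree_le (step _).
  elim: k {IH} => [|k IH]; first by rewrite addn0.
  by rewrite addnS (leq_trans IH).
(* the windows grow, so the letter of index n is settled after |n| steps *)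
pose b n := (p `|n|).1 n.
have agb j : agree (p j).2 (p j).1 b.
  move=> n nj; rewrite /b; case: (leqP j `|n|) => jn.
    by rewrite -(subnKC jn); apply: agp.
  by rewrite -(subnKC (ltnW jn)) -(agp `|n|)//; exact: pk.
exists b; first exact: (agb 0).
by move=> /AD[k _]; case: (fP k (p k)) => _ _; apply; exact: (agb k.+1).
Qed.

Definition cyl (a : int -> bool) (N : nat) : set (int -> bool) :=
  [set b | agree N a b].

(** There are countably many cylinders, since each one contains a sequence with
    finitely many ones.  This keeps the union in meager_local countable. *)
Lemma cyl_code a N : exists s : seq int, agree N a (fun n => n \in s).
Proof.
exists [seq i <- [seq Posz i | i <- iota 0 N.+1] ++
                 [seq (- Posz i)%R | i <- iota 0 N.+1] | a i].
move=> n nN; rewrite mem_filter.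
case: (a n); rewrite ?andbF// andTb; symmetry; rewrite mem_cat.
case: n nN => n nN.
  by rewrite map_f// mem_iota; lia.
rewrite NegzE; apply/orP; right; apply/mapP; exists n.+1 => //.
by rewrite mem_iota; lia.
Qed.

(** A set which is meager in densely many cylinders is meager: what lies outside
    those cylinders is nowhere dense, and there are only countably many of
    them. *)
Lemma meager_local A : (forall a N, exists b M,
    [/\ N <= M, agree N a b & meager (cyl b M `&` A)]) -> meager A.
Proof.
move=> loc.
pose good (i : seq int * nat) := meager (cyl (fun n => n \in i.1) i.2 `&` A).
pose U := \bigcup_(i in good) cyl (fun n => n \in i.1) i.2.
apply: (@meager_sub _ ((~` U) `|` (\bigcup_i (if asbool (good i) then
  cyl (fun n => n \in i.1) i.2 `&` A else set0)))).
  move=> x Ax; have [Ux|nUx] := pselect (U x); last by left.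
  by right; case: Ux => i gi xi; exists i => //; case: asboolP.
apply: meagerU; last first.
  apply: meager_bigcup => i; case: asboolP => //.
  by move=> _; exact: nowhere_dense_meager nowhere_dense0.
apply: nowhere_dense_meager => a N.
have [b [M [NM ab mb]]] := loc a N.
exists b, M; split => // c bc; apply.
have [s bs] := cyl_code b M.
exists (s, M); last exact: agree_trans (agree_sym bs) bc.
apply: meager_sub mb => x [] /= sx Ax; split => //.
exact: agree_trans sx.
Qed.

(** An equivalent of the Baire property: below every cylinder there is one in
    which A is either meager or comeager.  Unlike equality with an open set
    modulo a meager one, this form is visibly invariant under complement. *)
Definition decided (A : set (int -> bool)) : Prop :=
  forall a N, exists b M, [/\ N <= M, agree N a b &
    meager (cyl b M `&` A) \/ meager (cyl b M `&` ~` A)].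

Lemma decided_setC A : decided A -> decided (~` A).
Proof.
move=> dA a N; have [b [M [NM ab mA]]] := dA a N; exists b, M; split => //.
by rewrite setCK; case: mA; [right|left].
Qed.

(** If no cylinder below a given one makes some A n comeager, then every A n is
    meager in densely many cylinders there, hence meager, and so is the
    union. *)
Lemma decided_bigcup (A : nat -> set (int -> bool)) :
  (forall n, decided (A n)) -> decided (\bigcup_n A n).
Proof.
move=> dA a N.
have [[b [M [NM ab [n mn]]]]|nex] := pselect (exists b M, [/\ N <= M, agree N a b &
  exists n, meager (cyl b M `&` ~` A n)]).
  exists b, M; split => //; right; apply: meager_sub mn => x [bx nAx].
  by split => // Anx; apply: nAx; exists n.
exists a, N; split => //; left; rewrite setI_bigcupr.
apply: meager_bigcup => n; apply: meager_local => b M.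
(* cylinders that are incompatible with the given one are disjoint from it *)
have [agab|nagab] := pselect (agree (minn N M) a b); last first.
  exists b, (maxn N M); split; rewrite ?leq_maxr//.
  apply: (meager_sub _ (nowhere_dense_meager nowhere_dense0)).
  move=> x [bx [ax _]]; apply: nagab => k kNM; rewrite ax.
    by rewrite bx//; lia.
  by lia.
pose c n := if `|n| <= N then a n else b n.
have ac : agree N a c by move=> k kN; rewrite /c kN.
have bc : agree M b c.
  by move=> k kM; rewrite /c; case: ifP => // kN; rewrite agab//; lia.
have [d [L [cL cd mL]]] := dA n c (maxn N M).
exists d, L; split; first by lia.
  by apply: agree_trans bc _; apply: agree_le cd; lia.
case: mL => mL.
  by apply: meager_sub mL => x [dx [_ Ax]]; split.
case: nex; exists d, L; split; first by lia.
  by apply: agree_trans ac _; apply: agree_le cd; lia.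
by exists n.
Qed.

Definition cyl_open (U : set (int -> bool)) : Prop :=
  forall a, U a -> exists N, cyl a N `<=` U.

Lemma decided_open U : cyl_open U -> decided U.
Proof.
move=> oU a N.
have [[b [ab Ub]]|nU] := pselect (exists b, agree N a b /\ U b).
  have [M bM] := oU b Ub; exists b, (maxn N M); split; rewrite ?leq_maxl//.
  right; apply: (meager_sub _ (nowhere_dense_meager nowhere_dense0)).
  move=> x [bx]; apply; apply: bM; apply: agree_le bx; exact: leq_maxr.
exists a, N; split => //; left.
apply: (meager_sub _ (nowhere_dense_meager nowhere_dense0)) => x [ax Ux].
by apply: nU; exists x.
Qed.

Definition translate (k : int) (a : int -> bool) : int -> bool := fun n => a (n + k)%R.

(** Translating by k changes a window by at most |k| letters, so translation is
    a homeomorphism. *)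
Lemma meager_translate k A : meager A -> meager [set a | A (translate k a)].
Proof.
move=> [D [Dn AD]]; exists (fun n => [set a | D n (translate k a)]); split; last first.
  by move=> a /AD[n _ Dna]; exists n.
move=> n a N; have [b [M [NM ab bD]]] := Dn n (translate k a) (N + `|k|).
exists (translate (- k) b), (M + `|k|); split => //; first by lia.
  by move=> m mN; rewrite /translate -ab; [rewrite /translate subrK|lia].
move=> c bc; apply: bD => m mM.
by rewrite /translate -bc; [rewrite /translate addrK|lia].
Qed.

(** Translation is topologically transitive: the translates of a cylinder
    together form a dense open set.  So an invariant set which is comeager in
    one cylinder is comeager everywhere, and otherwise it is meager in densely
    many cylinders. *)
Theorem zero_one A : decided A ->
  (forall a, A (translate 1 a) <-> A a) -> meager A \/ meager (~` A).
Proof.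
move=> dA A1.
have Ak (k : nat) a : A (translate k a) <-> A a.
  elim: k a => [|k IH] a.
    by rewrite (_ : translate 0 a = a)//; apply/funext => n; rewrite /translate addr0.
  rewrite -[A a]A1 -(IH (translate 1 a)) (_ : translate k (translate 1 a) = translate k.+1 a)//.
  by apply/funext => n; rewrite /translate; congr (a _); lia.
have [[b [M mb]]|nex] := pselect (exists b M, meager (cyl b M `&` ~` A)); last first.
  left; apply: meager_local => a N; have [b [M [NM ab [mA|mA]]]] := dA a N.
    by exists b, M.
  by case: nex; exists b, M.
right.
have mk : meager (\bigcup_k [set a | (cyl b M `&` ~` A) (translate (Posz k) a)]).
  by apply: meager_bigcup => k; apply: meager_translate mb.
pose E := ~` (\bigcup_k [set a | cyl b M (translate (Posz k) a)]).
apply: (@meager_sub _ (E `|` \bigcup_k [set a | (cyl b M `&` ~` A) (translate (Posz k) a)])).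
  move=> x nAx; have [Ex|nEx] := pselect (E x); [by left|right].
  move: nEx => /contrapT [k _ bx]; exists k => //; split => //=.
  by rewrite Ak.
apply: meagerU mk; apply: nowhere_dense_meager => a N.
(* far enough for the window of b, moved by k, to avoid the window of a *)
pose k := Posz (N + M).+1.
exists (fun n => if `|n| <= N then a n else b (n - k)%R), (N + M + (N + M).+1).
split; [by lia|by move=> n ->|].
move=> c ac; apply; exists (N + M).+1 => // n nM.
rewrite /translate -ac; last by lia.
case: ifP; first by lia.
by rewrite addrK.
Qed.

(** * Borel maps from sequences of bits to Polish spaces *)

(** Sets with the Baire property form a sigma-algebra containing the open
    sets. *)
Lemma decided_borel (X : topologicalType) (f : (int -> bool) -> X) (B : set X) :
  (forall U, open U -> cyl_open (f @^-1` U)) ->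
  borel B -> decided (f @^-1` B).
Proof.
move=> fU; apply: (@smallest_sub _ _ (@open X) [set C : set X | decided (f @^-1` C)]).
  split => //=.
  - rewrite preimage_set0; apply: decided_open => a [].
  - by move=> C dC; rewrite setTD preimage_setC; exact: decided_setC.
  - by move=> C dC; rewrite preimage_bigcup; exact: decided_bigcup.
by move=> U /fU; exact: decided_open.
Qed.

(** By the zero-one law each basic ball of Y has a meager or a comeager
    preimage.  Off the countable union of the meager sets so obtained, all
    values lie in the same basic balls, hence are equal. *)
Lemma generic_constant (R : realType) (Y : topologicalType)
    (F : (int -> bool) -> Y) : polish R Y ->
  (forall U, open U -> decided (F @^-1` U)) ->
  (forall a, F (translate 1 a) = F a) ->
  exists2 N, meager N & forall a b, ~ N a -> ~ N b -> F a = F b.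
Proof.
move=> [[D cD dD] [d [d0 dC dT dN _]]] dF F1.
have dxx x : d x x = 0%R by exact/d0.
have d_ge0 x y : (0 <= d x y)%R.
  have := dT x y x; rewrite dxx (dC y x); lra.
pose ball y k := [set z | d y z < k.+1%:R^-1 :> R]%R.
have oball y k : open (ball y k).
  rewrite openE => z /= yz; apply/dN; exists (k.+1%:R^-1 - d y z)%R.
    by rewrite subr_gt0.
  move=> t /=; rewrite ltrBrDl => zt; exact: le_lt_trans (dT _ z _) zt.
have zo y k : meager (F @^-1` ball y k) \/ meager (~` (F @^-1` ball y k)).
  apply: zero_one => [|a]; first exact: dF.
  by rewrite /preimage mksetE F1.
have sep x y : x <> y -> exists2 z, D z & exists k, ball z k x /\ ~ ball z k y.
  move=> xy; have dxy : (0 < d x y)%R.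
    by rewrite lt_neqAle d_ge0 andbT eq_sym; apply/eqP => /d0.
  have /ltr_add_invr[k] : (0 < d x y / 2)%R by rewrite divr_gt0.
  rewrite add0r => kxy.
  have [z [zx Dz]] : ball x k `&` D !=set0.
    by apply: dD; [exists x; rewrite /ball /= dxx invr_gt0|exact: oball].
  exists z => //; exists k; rewrite /ball /= dC; split => //.
  move: zx xy kxy; rewrite /ball /=; set r := (_^-1)%R => zx _ kxy zy.
  by have := dT x z y; lra.
have [f fD] : exists f : nat -> set Y, (forall n, exists y, f n `<=` [set y]) /\
    D = \bigcup_n f n.
  move: cD; rewrite /countable => /pfcard_geP[->|[g]].
    exists (fun=> set0); split; last by rewrite bigcup0.
    by move=> _; exists (F (fun=> true)).
  exists (fun n => [set g n] `&` D); split.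
    by move=> n; exists (g n) => z [].
  apply/seteqP; split => [z Dz|z [n _ []]//].
  by have [n _ gn] := 'surj_g Dz; exists n => //; split.
pose M y k := if asbool (meager (F @^-1` ball y k)) then F @^-1` ball y k
  else ~` (F @^-1` ball y k).
have mM y k : meager (M y k).
  by rewrite /M; case: asboolP => // ?; case: (zo y k).
exists (\bigcup_n \bigcup_(y in f n) \bigcup_k M y k).
  apply: meager_bigcup => n; have [y fy] := fD.1 n.
  apply: (@meager_sub _ (\bigcup_k M y k)); last exact: meager_bigcup.
  by move=> x [z /fy ->].
move=> a b na nb; apply: contrapT => ab.
have [z Dz [k [az bz]]] := sep _ _ ab.
move: Dz; rewrite fD.2 => -[n _ fnz].
have [Mz] : (F @^-1` ball z k) a /\ (~` (F @^-1` ball z k)) b by [].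
have naM : ~ M z k a.
  by move=> Ma; apply: na; exists n => //; exists z => //; exists k.
have nbM : ~ M z k b.
  by move=> Ma; apply: nb; exists n => //; exists z => //; exists k.
by move: naM nbM; rewrite /M; case: asboolP.
Qed.

(** * A profile with a bi-infinite sequence of multiple zeros *)

Local Open Scope ring_scope.
Local Open Scope quotient_scope.

Lemma is_derive_cvg (R : numFieldType) (V W : normedModType R) (f : V -> W) x v df :
  h^-1 *: (f (h *: v + x) - f x) @[h --> (0 : R)^'] --> df -> is_derive x v f df.
Proof. by move=> fdf; apply: DeriveDef; [apply/cvg_ex; exists df|apply/cvg_lim]. Qed.

Section Profile.
Variable R : realType.
Implicit Types (x y t : R) (n : int).

Definition cs y : R := cos (pi * y).
Definition sn y : R := sin (pi * y).
Definition tn y : R := tan (pi * y).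

Lemma sn_int n : sn n%:~R = 0.
Proof.
have sn_nat (m : nat) : sn m%:R = 0.
  rewrite /sn mulr_natr -[_ *+ _]add0r (alternatingn (@sinDpi R)).
  by rewrite sin0 mulr0.
case: n => n; first exact: sn_nat.
by rewrite NegzE rmorphN/= /sn mulrN sinN -/(sn _) sn_nat oppr0.
Qed.

Lemma snD x y : sn (x + y) = sn x * cs y + cs x * sn y.
Proof. by rewrite /sn mulrDr sinD. Qed.

Lemma csD x y : cs (x + y) = cs x * cs y - sn x * sn y.
Proof. by rewrite /cs mulrDr cosD. Qed.

Lemma csN x : cs (- x) = cs x.
Proof. by rewrite /cs mulrN cosN. Qed.

Lemma snN x : sn (- x) = - sn x.
Proof. by rewrite /sn mulrN sinN. Qed.

Lemma cs2sn2 x : cs x ^+ 2 + sn x ^+ 2 = 1.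
Proof. exact: cos2Dsin2. Qed.

Lemma cs2_int n : cs n%:~R ^+ 2 = 1.
Proof. by have := cs2sn2 n%:~R; rewrite sn_int expr0n addr0. Qed.

Lemma cs_int_neq0 n : cs n%:~R != 0.
Proof. by rewrite -sqrf_eq0 cs2_int oner_eq0. Qed.

Lemma cs2Dint y n : cs (y + n%:~R) ^+ 2 = cs y ^+ 2.
Proof. by rewrite csD sn_int mulr0 subr0 exprMn cs2_int mulr1. Qed.

Lemma tnE y : tn y = sn y / cs y. Proof. by []. Qed.

Lemma tnDint y n : tn (y + n%:~R) = tn y.
Proof.
rewrite !tnE csD snD sn_int !mulr0 subr0 addr0.
by rewrite -mulf_div divff ?mulr1// cs_int_neq0.
Qed.

(** The zeros of sin (pi t) are exactly the integers; the heights of the rest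
    circles are read off from this. *)
Lemma sn_eq0 t : (sn t == 0) = (t \is a Num.int).
Proof.
apply/idP/idP => [|/intrP[n ->]]; last by rewrite sn_int.
apply: contraLR => tint.
have t_ge := floor_le t; have t_lt := floorD1_gt t.
have tfl : (Num.floor t)%:~R < t.
  rewrite lt_neqAle t_ge andbT; apply: contra tint => /eqP <-.
  exact: intr_int.
rewrite -[t](subrK (Num.floor t)%:~R) snD sn_int mulr0 addr0 mulf_neq0//.
  rewrite gt_eqF// /sn sin_gt0_pi// mulr_gt0 ?pi_gt0 ?subr_gt0//=.
  rewrite -[ltRHS]mulr1 ltr_pM2l ?pi_gt0// ltrBlDl.
  by rewrite intrD in t_lt.
exact: cs_int_neq0.
Qed.

Definition sntn y : R := sn (tn y).
Definition cstn y : R := cs (tn y).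

Global Instance is_derive_cs y : is_derive y 1 cs (- pi * sn y).
Proof.
apply: (is_derive_eq (is_derive1_comp (is_derive_cos _) (is_deriveZ pi (is_derive_id y 1)))).
by rewrite /sn /= scaler1 mulrC; lra.
Qed.

Global Instance is_derive_sn y : is_derive y 1 sn (pi * cs y).
Proof.
apply: (is_derive_eq (is_derive1_comp (is_derive_sin _) (is_deriveZ pi (is_derive_id y 1)))).
by rewrite /cs /= scaler1 mulrC.
Qed.

Lemma is_derive_tn y : cs y != 0 -> is_derive y 1 tn (pi / cs y ^+ 2).
Proof.
move=> cy.
apply: (is_derive_eq (is_derive1_comp (is_derive_tan cy) (is_deriveZ pi (is_derive_id y 1)))).
by rewrite /cs /= scaler1 mulrC.
Qed.

Lemma is_derive_sntn y : cs y != 0 -> is_derive y 1 sntn (pi ^+ 2 * cstn y / cs y ^+ 2).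
Proof.
move=> cy; apply: (is_derive_eq (is_derive1_comp (is_derive_sn _) (is_derive_tn cy))).
by rewrite -/(cstn y); field.
Qed.

Lemma is_derive_cstn y : cs y != 0 -> is_derive y 1 cstn (- pi ^+ 2 * sntn y / cs y ^+ 2).
Proof.
move=> cy; apply: (is_derive_eq (is_derive1_comp (is_derive_cs _) (is_derive_tn cy))).
by rewrite -/(sntn y); field.
Qed.

(** Boundedness on the whole line, closed under sums and products; it makes the
    bounds on the profile a matter of syntax. *)
Definition bdd (f : R -> R) := exists C : R, forall y, `|f y| <= C.

Lemma bdd_cst a : bdd (fun=> a). Proof. by exists `|a|. Qed.

Lemma bddD f g : bdd f -> bdd g -> bdd (fun y => f y + g y).
Proof.
move=> [C fC] [D gD]; exists (C + D) => y.
by rewrite (le_trans (ler_normD _ _))// lerD.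
Qed.

Lemma bddM f g : bdd f -> bdd g -> bdd (fun y => f y * g y).
Proof.
by move=> [C fC] [D gD]; exists (C * D) => y; rewrite normrM ler_pM.
Qed.

Lemma bddX f (n : nat) : bdd f -> bdd (fun y => f y ^+ n).
Proof.
move=> bf; elim: n => [|n IH]; first by under eq_fun do rewrite expr0; exact: bdd_cst.
by under eq_fun do rewrite exprS; exact: bddM.
Qed.

Lemma bdd_cs : bdd cs. Proof. by exists 1 => y; exact: cos_max. Qed.
Lemma bdd_sn : bdd sn. Proof. by exists 1 => y; exact: sin_max. Qed.
Lemma bdd_sntn : bdd sntn. Proof. by exists 1 => y; exact: sin_max. Qed.
Lemma bdd_cstn : bdd cstn. Proof. by exists 1 => y; exact: cos_max. Qed.

(** The profile damped ripple0 is cos(pi y)^6 sin(pi tan(pi y))^4.  The power 4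
    gives zeros of order 4 at the points with tan (pi y) an integer.  Each
    derivative of tan costs a factor cs^-2, so the power 6 leaves a factor
    cs^2 after two derivatives, and ripple1 and ripple2 are what remains. *)
Definition ripple0 y := cs y ^+ 4 * sntn y ^+ 4.
Definition ripple1 y := - 6 * pi * (sn y * cs y ^+ 3 * sntn y ^+ 4)
  + 4 * pi ^+ 2 * (cs y ^+ 2 * sntn y ^+ 3 * cstn y).
Definition ripple2 y := sntn y ^+ 2 * (- 6 * pi ^+ 2 * (cs y ^+ 4 * sntn y ^+ 2)
  + 30 * pi ^+ 2 * (sn y ^+ 2 * cs y ^+ 2 * sntn y ^+ 2)
  + - 40 * pi ^+ 3 * (sn y * cs y * sntn y * cstn y)
  + 12 * pi ^+ 4 * cstn y ^+ 2 + - 4 * pi ^+ 4 * sntn y ^+ 2).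

(** The functions below oscillate infinitely often near the poles, the points
    where cs vanishes; a bounded one multiplied by cs^2 is
    continuous there. *)
Definition damped (B : R -> R) y := cs y ^+ 2 * B y.

Ltac bdd_tac := repeat first [exact: bdd_cst | exact: bdd_cs | exact: bdd_sn
  | exact: bdd_sntn | exact: bdd_cstn | exact: bddX bdd_cs | exact: bddX bdd_sn
  | exact: bddX bdd_sntn | exact: bddX bdd_cstn | apply: bddD | apply: bddM].

Lemma bdd_ripple0 : bdd ripple0. Proof. by rewrite /ripple0; bdd_tac. Qed.
Lemma bdd_ripple1 : bdd ripple1. Proof. by rewrite /ripple1; bdd_tac. Qed.
Lemma bdd_ripple2 : bdd ripple2. Proof. by rewrite /ripple2; bdd_tac. Qed.

(** Used twice: with g a power of cs at a pole, and with g the profile when f is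
    the profile multiplied by arbitrary signs. *)
Lemma is_derive_squeeze (f g : R -> R) y :
  (forall x, `|f x| <= `|g x|) -> g y = 0 -> is_derive y 1 g 0 -> is_derive y 1 f 0.
Proof.
move=> fg gy [dg g0]; apply: is_derive_cvg.
have fy : f y = 0 by apply/eqP; rewrite -normr_le0 (le_trans (fg y))// gy normr0.
move: dg => /cvg_ex[l gl]; have l0 : l = 0 by rewrite -g0; symmetry; exact: cvg_lim gl.
move: gl; rewrite l0 => /cvg_norm; rewrite normr0 => gl; apply: norm_cvg0.
apply: (squeeze_cvgr _ (cvg_cst 0) gl); near=> h; rewrite normr_ge0 /=.
by rewrite fy gy !subr0 !normrM ler_wpM2l.
Unshelve. all: by end_near. Qed.

Lemma continuous_squeeze (f g : R -> R) y :
  (forall x, `|f x| <= `|g x|) -> g y = 0 -> {for y, continuous g} -> {for y, continuous f}.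
Proof.
move=> fg gy; rewrite /prop_for /continuous_at gy.
have -> : f y = 0 by apply/eqP; rewrite -normr_le0 (le_trans (fg y))// gy normr0.
move=> /cvg_norm; rewrite normr0 => cg; apply: norm_cvg0.
by apply: (squeeze_cvgr _ (cvg_cst 0) cg); near=> h; rewrite normr_ge0 /=.
Unshelve. all: by end_near. Qed.

Lemma is_derive_damped_pole B y : bdd B -> cs y = 0 -> is_derive y 1 (damped B) 0.
Proof.
move=> [C BC] cy; apply: (@is_derive_squeeze _ (C *: cs ^+ 2)).
- move=> x; rewrite (_ : (C *: _) x = C * cs x ^+ 2); last by rewrite !fctE.
  rewrite /damped [X in `|X|]mulrC normrM [leRHS]normrM ler_wpM2r//.
  by rewrite (le_trans (BC x))// ler_norm.
- by rewrite !fctE cy expr0n scaler0.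
- by apply: is_derive_eq; rewrite /= cy expr1 mulr0 scale0r scaler0.
Qed.

Lemma is_derive_damped0 y : is_derive y 1 (damped ripple0) (damped ripple1 y).
Proof.
have [cy|cy] := eqVneq (cs y) 0.
  by rewrite [damped ripple1 y]/damped cy expr0n mul0r; exact: is_derive_damped_pole bdd_ripple0 cy.
have dw := is_derive_sntn cy.
rewrite (_ : damped ripple0 = cs ^+ 6 * sntn ^+ 4); last first.
  by apply/funext => x; rewrite /damped /ripple0 !fctE; ring.
apply: is_derive_eq.
rewrite /damped /ripple1 !fctE /GRing.scale /=.
by field.
Qed.

Lemma is_derive_damped1 y : is_derive y 1 (damped ripple1) (damped ripple2 y).
Proof.
have [cy|cy] := eqVneq (cs y) 0.
  by rewrite [damped ripple2 y]/damped cy expr0n mul0r; exact: is_derive_damped_pole bdd_ripple1 cy.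
have dw := is_derive_sntn cy; have dz := is_derive_cstn cy.
have d1 : is_derive y 1 (cs ^+ 4 * sntn ^+ 3)
    (cs y ^+ 4 * (3 * sntn y ^+ 2 * (pi ^+ 2 * cstn y / cs y ^+ 2)) +
     sntn y ^+ 3 * (4 * cs y ^+ 3 * (- pi * sn y))) by apply: is_derive_eq.
have d2 : is_derive y 1 (sn * cs ^+ 5)
    (sn y * (5 * cs y ^+ 4 * (- pi * sn y)) + cs y ^+ 5 * (pi * cs y)).
  by apply: is_derive_eq.
have d3 := is_deriveD (is_deriveZ (- 6 * pi) (is_deriveM d2 (is_deriveX 4 dw)))
  (is_deriveZ (4 * pi ^+ 2) (is_deriveM d1 dz)).
rewrite (_ : damped ripple1 = (- 6 * pi) *: (sn * cs ^+ 5 * sntn ^+ 4)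
    + (4 * pi ^+ 2) *: (cs ^+ 4 * sntn ^+ 3 * cstn)); last first.
  by apply/funext => x; rewrite /damped /ripple1 !fctE /GRing.scale /=; ring.
apply: (is_derive_eq d3).
rewrite /damped /ripple2 !fctE /GRing.scale /=.
by field.
Qed.

Lemma continuous_is_derive (f : R -> R) y d : is_derive y 1 f d -> {for y, continuous f}.
Proof. by move=> [df _]; apply/differentiable_continuous/derivable1_diffP. Qed.

Lemma continuous_damped2 : continuous (damped ripple2).
Proof.
move=> y; have [cy|cy] := eqVneq (cs y) 0.
  exact: continuous_is_derive (is_derive_damped_pole bdd_ripple2 cy).
have cw := continuous_is_derive (is_derive_sntn cy).
have cz := continuous_is_derive (is_derive_cstn cy).
have cc := continuous_is_derive (is_derive_cs y).
have cn := continuous_is_derive (is_derive_sn y).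
have ck (a : R) : {for y, continuous (fun=> a)} by exact: cst_continuous.
have cD (f g : R -> R) : {for y, continuous f} -> {for y, continuous g} ->
    {for y, continuous (fun x => f x + g x)} by move=> cf cg; exact: continuousD.
have cM (f g : R -> R) : {for y, continuous f} -> {for y, continuous g} ->
    {for y, continuous (fun x => f x * g x)} by move=> cf cg; exact: continuousM.
have cX (f : R -> R) (n : nat) : {for y, continuous f} -> {for y, continuous (fun x => f x ^+ n)}.
  by move=> cf; apply: (@continuous_comp _ _ _ f (fun t : R => t ^+ n)) => //;
    exact: exprn_continuous.
rewrite /damped /ripple2.
repeat first [exact: ck | exact: cw | exact: cz | exact: cc
  | exact: cn | apply: (cX) | apply: (cD) | apply: (cM)].
Qed.

(** The heights of the rest circles of all the coded fields: the poles (cs = 0)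
    and the solutions of tan (pi y) in Z (sntn = 0). *)
Definition still y : Prop := cs y = 0 \/ sntn y = 0.

Lemma damped_still y : still y ->
  [/\ damped ripple0 y = 0, damped ripple1 y = 0 & damped ripple2 y = 0].
Proof.
by rewrite /damped /ripple0 /ripple1 /ripple2 => -[->|->]; split;
  rewrite !expr0n /= ?(mulr0, mul0r, addr0).
Qed.

(** The bit of index n governs the points with n < tan (pi y) < n + 1. *)
Definition sgn (e : int -> bool) y : R := (- 1) ^+ e (Num.floor (tn y)).

Lemma norm_sgn e y : `|sgn e y| = 1.
Proof. by rewrite /sgn normrX normrN1 expr1n. Qed.

Lemma sgnDint e y n : sgn e (y + n%:~R) = sgn e y.
Proof. by rewrite /sgn tnDint. Qed.

Lemma floor_near t : t \isn't a Num.int -> \forall x \near t, Num.floor x = Num.floor t.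
Proof.
move=> tint.
have t_lt := floorD1_gt t.
have tfl : (Num.floor t)%:~R < t.
  rewrite lt_neqAle floor_le andbT; apply: contra tint => /eqP <-.
  exact: intr_int.
near=> x; apply: floor_def; apply/andP; split.
  by apply: ltW; near: x; exact: lt_nbhsr.
by near: x; exact: lt_nbhsl.
Unshelve. all: by end_near. Qed.

(** Between two consecutive rest heights the floor of tan (pi y) is constant. *)
Lemma sgn_near e y : ~ still y -> \forall x \near y, sgn e x = sgn e y.
Proof.
move=> ny.
have cy : cs y != 0 by apply/eqP => ?; apply: ny; left.
have wy : tn y \isn't a Num.int by rewrite -sn_eq0; apply/eqP => ?; apply: ny; right.
have := continuous_is_derive (is_derive_tn cy) (floor_near wy).
rewrite /= nbhs_filterE => near_floor.
have : \forall x \near y, Num.floor (tn x) = Num.floor (tn y) by exact: near_floor.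
by apply: filterS => x; rewrite /sgn => ->.
Qed.

(** The signs jump only at rest heights, where both the function and its
    derivative vanish; there the jump is squeezed out. *)
Lemma is_derive_sgn e B (B' : R -> R) y :
  (forall y, is_derive y 1 (damped B) (damped B' y)) ->
  (still y -> damped B y = 0) -> (still y -> damped B' y = 0) ->
  is_derive y 1 (sgn e \* damped B) (sgn e y * damped B' y).
Proof.
move=> dB By B'y; have [fy|fy] := pselect (still y).
  rewrite B'y// mulr0; apply: (@is_derive_squeeze _ (damped B)).
  - by move=> x; rewrite normrM norm_sgn mul1r.
  - exact: By.
  - by rewrite -(B'y fy).
apply: (@near_eq_is_derive _ _ _ (sgn e y *: damped B)).
by have := sgn_near e fy; apply: filterS => x /= ->.
Qed.

Lemma continuous_sgn_damped2 e : continuous (sgn e \* damped ripple2).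
Proof.
move=> y; have [fy|fy] := pselect (still y).
  apply: (@continuous_squeeze _ (damped ripple2)).
  - by move=> x; rewrite /= normrM norm_sgn mul1r.
  - by have [] := damped_still fy.
  - exact: continuous_damped2.
have : {for y, continuous (sgn e y *: damped ripple2)}.
  by apply: continuousZr; exact: continuous_damped2.
rewrite /prop_for /continuous_at /=; apply: cvg_trans.
by apply: near_eq_cvg; have := sgn_near e fy; apply: filterS => x /= ->.
Qed.

(** A large value of tan (pi y) means a small value of cs^2 = 1 / (1 + tan^2). *)
Lemma damped_small (B : R -> R) : bdd B -> forall r : R, 0 < r -> exists N : nat,
  forall y, (N < `|Num.floor (tn y)|)%N -> `|damped B y| < r.
Proof.
move=> [C BC] r r0; have [N CN] : exists N : nat, C / r < N%:R.
  exists (Num.truncn (C / r)).+1; exact: truncnS_gt.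
exists N => y Ny.
have [cy|cy] := eqVneq (cs y) 0; first by rewrite /damped cy expr0n mul0r normr0.
have : 1 + tn y ^+ 2 = cs y ^- 2 by rewrite /tn -cos2_tan2.
have tN : N%:R <= `|tn y|.
  have t_ge := floor_le (tn y); have t_lt := floorD1_gt (tn y).
  have [N1|N1] : (Posz N.+1 <= Num.floor (tn y)) \/
      (Num.floor (tn y) + 1 <= - Posz N) by lia.
    rewrite (le_trans _ (ler_norm _))// (le_trans _ t_ge)//.
    by rewrite (le_trans _ (_ : (Posz N.+1)%:~R <= _)) ?ler_int// ler_nat.
  rewrite -normrN (le_trans _ (ler_norm _))// lerNr (le_trans (ltW t_lt))//.
  by rewrite -[- _]/(- (Posz N)%:~R) -rmorphN/= ler_int.
move=> ct; rewrite /damped normrM normrX real_normK ?num_real//.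
have c0 : 0 < cs y ^+ 2 by rewrite lt_neqAle eq_sym sqrf_eq0 cy sqr_ge0.
have c1 : cs y ^+ 2 * (1 + tn y ^+ 2) = 1 by rewrite ct divff// gt_eqF.
rewrite ltr_pdivrMr// in CN.
have N2 : N%:R <= 1 + tn y ^+ 2 :> R.
  rewrite -[_ ^+ 2]real_normK ?num_real//; move: tN.
  have := normr_ge0 (tn y); nra.
rewrite (le_lt_trans (ler_wpM2l (ltW c0) (BC y)))//.
rewrite (lt_le_trans (_ : _ < cs y ^+ 2 * (N%:R * r)))// ?ltr_pM2l//.
rewrite mulrA -[leRHS]mul1r -{2}c1 ler_wpM2r ?(ltW r0)//.
by rewrite ler_wpM2l// ltW.
Qed.

End Profile.

(** * The torus and the coded vector fields *)

Section TorusFacts.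
Variable R : realType.
Local Notation T := (torus R).
Local Notation P := (@torus_proj R).

Lemma torus_projE (x y : R * R) : P x = P y <-> lattice_rel x y.
Proof.
by split=> [xy|/eqmodP xy]; [apply/(@eqmodP _ (lattice_equiv R)); exact: xy|exact: xy].
Qed.

Lemma torus_projP (x y : R * R) : P x = P y <->
  exists m n : int, x = (y.1 + m%:~R, y.2 + n%:~R).
Proof.
rewrite torus_projE /lattice_rel; split.
  move=> /andP[/intrP[m xm] /intrP[n xn]]; exists m, n.
  by rewrite -xm -xn [in RHS]addrC subrK [_ + (_ - _)]addrC subrK; case: x {xm xn}.
move=> [m [n ->]] /=; rewrite ![_ + _ - _]addrAC !subrr !add0r.
by rewrite !intr_int.
Qed.

(** A chosen lift to the plane; it is not continuous, and is only used through
    functions that are invariant under the lattice. *)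
Definition rep (p : T) : R * R := repr p.

Lemma repK p : P (rep p) = p.
Proof. exact: reprK. Qed.

Lemma torus_proj_continuous : continuous P.
Proof. exact: pi_continuous. Qed.

Lemma torus_continuous (Z : topologicalType) (f : T -> Z) :
  continuous f <-> continuous (f \o P).
Proof. exact: quotient_continuous. Qed.

Lemma rep_proj (x : R * R) : exists m n : int, rep (P x) = (x.1 + m%:~R, x.2 + n%:~R).
Proof. by apply/torus_projP; rewrite repK. Qed.

End TorusFacts.

Section HorizontalFields.
Variable R : realType.
Implicit Types (f : R -> R) (p : R * R) (y : R).

Definition horizontal f (p : R * R) : R * R := (f p.2, 0).

Lemma is_derive_horizontal01 f (d : R) p :
  is_derive p.2 1 f d -> is_derive p (0, 1) (horizontal f) (d, 0).
Proof.
move=> [/cvg_ex[l fl] fd].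
have ld : l = d by rewrite -fd; symmetry; exact: cvg_lim fl.
apply: is_derive_cvg.
rewrite (_ : (fun h => _) = (fun h => (h^-1 *: (f (h *: 1 + p.2) - f p.2), 0))).
  apply: (@cvg_pair _ _ _ _ (nbhs d) (nbhs (0 : R))); last exact: cvg_cst.
  by rewrite -ld; exact: fl.
by apply/funext => h; rewrite /horizontal; congr pair; rewrite /= subr0 scaler0.
Qed.

Lemma is_derive_horizontal10 f p : is_derive p (1, 0) (horizontal f) (0, 0).
Proof.
apply: is_derive_cvg.
rewrite (_ : (fun h => _) = (fun=> (0, 0))); first exact: cvg_cst.
apply/funext => h; rewrite /horizontal /= scaler0 add0r.
by congr pair; rewrite /= subrr scaler0.
Qed.

(** Derivatives of the lifted fields reduce to derivatives of functions of the
    height. *)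
Lemma derive_horizontal01 f f' : (forall y : R, is_derive y 1 f (f' y)) ->
  'D_(0, 1) (horizontal f) = horizontal f'.
Proof.
move=> ff'; apply/funext => p.
by have [_] := is_derive_horizontal01 (ff' p.2).
Qed.

Lemma derive_horizontal10 f : 'D_(1, 0) (horizontal f) = horizontal (fun=> 0).
Proof.
apply/funext => p.
by have [_] := is_derive_horizontal10 f p.
Qed.

Lemma continuous_horizontal f : continuous f -> continuous (horizontal f).
Proof.
move=> cf p; apply: (@cvg_pair _ _ _ _ (nbhs (f p.2)) (nbhs (0 : R))); last exact: cvg_cst.
by apply: (@continuous_comp _ _ _ snd f); [exact: cvg_snd|exact: cf].
Qed.

Lemma smooth_horizontal0 k : smooth_class k (horizontal (fun=> 0)).
Proof.
have c0 : continuous (horizontal (fun=> 0)).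
  by apply: continuous_horizontal; exact: cst_continuous.
elim: k => [//|k IH]; split => //; split.
- by move=> p; have [] := is_derive_horizontal10 (fun=> 0) p.
- by move=> p; have [] := is_derive_horizontal01 (is_derive_cst 0 p.2 1).
- by rewrite derive_horizontal10.
- by rewrite (@derive_horizontal01 _ (fun=> 0)).
Qed.

Lemma smooth_horizontalS k f f' : (forall y : R, is_derive y 1 f (f' y)) ->
  smooth_class k (horizontal f') -> smooth_class k.+1 (horizontal f).
Proof.
move=> ff' sf'; split; last split.
- by apply: continuous_horizontal => y; exact: continuous_is_derive (ff' y).
- by move=> p; have [] := is_derive_horizontal10 f p.
- by move=> p; have [] := is_derive_horizontal01 (ff' p.2).
- by rewrite derive_horizontal10; exact: smooth_horizontal0.
- by rewrite (derive_horizontal01 ff').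
Qed.

(** The horizontal speed of the coded field at height y, and its first two
    derivatives. *)
Definition speed (e : int -> bool) (y : R) : R := sgn e y * damped (@ripple0 R) y.
Definition speed1 (e : int -> bool) (y : R) : R := sgn e y * damped (@ripple1 R) y.
Definition speed2 (e : int -> bool) (y : R) : R := sgn e y * damped (@ripple2 R) y.

Lemma is_derive_speed e y : is_derive y 1 (speed e) (speed1 e y).
Proof.
by apply: is_derive_sgn; [exact: is_derive_damped0|move=> /damped_still[]..].
Qed.

Lemma is_derive_speed1 e y : is_derive y 1 (speed1 e) (speed2 e y).
Proof.
by apply: is_derive_sgn; [exact: is_derive_damped1|move=> /damped_still[]..].
Qed.

Lemma speedDint e y (n : int) : speed e (y + n%:~R) = speed e y.
Proof.
have c4 : cs (y + n%:~R) ^+ 4 = cs y ^+ 4 by rewrite !(exprM _ 2 2) cs2Dint.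
by rewrite /speed sgnDint /damped /ripple0 /sntn tnDint cs2Dint c4.
Qed.

Definition coded_field_fun e (p : torus R) : R * R := horizontal (speed e) (rep p).

Lemma coded_field_fun_proj e : coded_field_fun e \o @torus_proj R = horizontal (speed e).
Proof.
apply/funext => x; rewrite /coded_field_fun /= /horizontal.
by have [m [n ->]] := rep_proj x; rewrite speedDint.
Qed.

Lemma coded_field_fun_C2 e : smooth_class 2 (coded_field_fun e \o @torus_proj R).
Proof.
rewrite coded_field_fun_proj; apply: smooth_horizontalS (is_derive_speed e) _.
apply: smooth_horizontalS (is_derive_speed1 e) _; split => //.
by apply: continuous_horizontal; exact: continuous_sgn_damped2.
Qed.

Definition coded_field e : vfield R := VField (coded_field_fun_C2 e).

Lemma coded_fieldE e x : coded_field e (torus_proj x) = (speed e x.2, 0).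
Proof. exact: (congr1 (@^~ x) (coded_field_fun_proj e)). Qed.

Lemma jet2_eq (v : vfield R) (g g1 g2 g11 g12 g21 g22 : R * R -> R * R) :
  v \o @torus_proj R = g -> 'D_(1, 0) g = g1 -> 'D_(0, 1) g = g2 ->
  'D_(1, 0) g1 = g11 -> 'D_(0, 1) g1 = g12 ->
  'D_(1, 0) g2 = g21 -> 'D_(0, 1) g2 = g22 ->
  jet2 v = fun x => (g x, (g1 x, g2 x), ((g11 x, g12 x), (g21 x, g22 x))).
Proof. by move=> <- <- <- <- <- <- <-. Qed.

Lemma jet2_coded_field e (x : R * R) : jet2 (coded_field e) x =
  ((speed e x.2, 0), ((0, 0), (speed1 e x.2, 0)),
   (((0, 0), (0, 0)), ((0, 0), (speed2 e x.2, 0)))).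
Proof.
by rewrite (@jet2_eq (coded_field e) _ _ _ _ _ _ _ (coded_field_fun_proj e) (derive_horizontal10 _)
  (derive_horizontal01 (is_derive_speed e)) (derive_horizontal10 _)
  (derive_horizontal01 (fun y => is_derive_cst 0 y 1)) (derive_horizontal10 _)
  (derive_horizontal01 (is_derive_speed1 e))).
Qed.

(** Two codes that agree on a large window give the same speed where
    tan (pi y) is in the window; elsewhere both speeds are tiny. *)
Lemma sgn_damped_close B (r : R) : bdd B -> 0 < r -> exists N, forall e a y,
  agree N e a -> `|sgn e y * damped B y - sgn a y * damped B y| < r.
Proof.
move=> bB r0; have [|N NB] := damped_small bB (_ : 0 < r / 2); first by rewrite divr_gt0.
exists N => e a y ea; have [yN|/NB By] := leqP `|Num.floor (tn y)| N.
  by rewrite /sgn (ea _ yN) subrr normr0.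
by rewrite (le_lt_trans (ler_normB _ _))// 2!(normrM (sgn _ _)) !norm_sgn !mul1r [ltRHS]splitr ltrD.
Qed.

Lemma coded_field_continuous (U : set (vfield R)) : open U -> cyl_open (coded_field @^-1` U).
Proof.
move=> [W oW <-] e We.
have : nbhs (jet2 (coded_field e)) W by exact: open_nbhs_nbhs.
move=> /uniform_nbhs [E [entE EW]].
move: entE; rewrite -entourage_ballE => -[r /= r0 rE].
have [N0 s0] := sgn_damped_close (@bdd_ripple0 R) r0.
have [N1 s1] := sgn_damped_close (@bdd_ripple1 R) r0.
have [N2 s2] := sgn_damped_close (@bdd_ripple2 R) r0.
exists (maxn N0 (maxn N1 N2)) => a ea; apply: EW => x _; apply: rE => /=.
have /(s0 _ _ x.2) {}s0 : agree N0 e a by apply: agree_le ea; lia.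
have /(s1 _ _ x.2) {}s1 : agree N1 e a by apply: agree_le ea; lia.
have /(s2 _ _ x.2) {}s2 : agree N2 e a by apply: agree_le ea; lia.
rewrite !jet2_coded_field.
have b0 : ball (0 : R) r (0 : R) by exact: ballxx.
by repeat split.
Qed.

End HorizontalFields.

(** * Integral curves, and the translation of a code *)

Section Curves.
Variable R : realType.
Local Notation P := (@torus_proj R).

Lemma is_derive_pair (x : R -> R * R) (t a b : R) :
  is_derive t 1 x (a, b) <->
  is_derive t 1 (fst \o x) a /\ is_derive t 1 (snd \o x) b.
Proof.
split=> [[/cvg_ex[l xl] xab]|[[/cvg_ex[l xl] xa] [/cvg_ex[m xm] xb]]].
  have lab : l = (a, b) by rewrite -xab; symmetry; exact: cvg_lim xl.
  rewrite lab in xl; split; apply: is_derive_cvg.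
    exact: (cvg_comp _ _ xl (@cvg_fst _ _ (nbhs a) (nbhs b) _)).
  exact: (cvg_comp _ _ xl (@cvg_snd _ _ (nbhs a) (nbhs b) _)).
have la : l = a by rewrite -xa; symmetry; exact: cvg_lim xl.
have mb : m = b by rewrite -xb; symmetry; exact: cvg_lim xm.
rewrite la in xl; rewrite mb in xm.
by apply: is_derive_cvg; exact: cvg_pair xl xm.
Qed.

(** The height is constant along an integral curve, so the equation is solved
    explicitly: the curves move uniformly along horizontal circles. *)
Lemma integral_curveP (e : int -> bool) (c : R -> torus R) :
  integral_curve (coded_field R e) c <->
  exists a b, c = fun t => P (a + speed e b * t, b).
Proof.
split=> [[x -> dx]|[a [b ->]]].
  have dx' (t : R) : is_derive t 1 (fst \o x) (speed e (x t).2) /\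
      is_derive t 1 (snd \o x) 0.
    by apply/is_derive_pair; rewrite -coded_fieldE; exact: dx.
  have x2 t : (x t).2 = (x 0).2.
    by apply: (@is_derive_0_is_cst _ (snd \o x)) => s; have [] := dx' s.
  exists (x 0).1, (x 0).2; apply/funext => t /=; congr P.
  rewrite [LHS]surjective_pairing x2; congr pair.
  pose s := speed e (x 0).2.
  have /(_ t 0) : forall t u, ((fst \o x) - s *: id) t = ((fst \o x) - s *: id) u.
    move=> t' u'; apply: is_derive_0_is_cst => u.
    have [d1 _] := dx' u; rewrite x2 -/s in d1.
    apply: (is_derive_eq (is_deriveB d1 (is_deriveZ s (is_derive_id u 1)))).
    by rewrite scaler1 subrr.
  rewrite !fctE scaler0 subr0 => /eqP; rewrite subr_eq => /eqP ->.
  by [].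
exists (fun t => (a + speed e b * t, b)) => // t.
rewrite coded_fieldE; apply/is_derive_pair; split.
  have d := is_deriveD (is_derive_cst a t 1) (is_deriveZ (speed e b) (is_derive_id t 1)).
  by apply: (is_derive_eq d); rewrite add0r scaler1.
exact: is_derive_cst.
Qed.

End Curves.

Section VerticalShift.
Variable R : realType.
Local Notation T := (torus R).
Local Notation P := (@torus_proj R).

(** The saturation of an open set is the union of its translates by the
    lattice. *)
Lemma proj_open (A : set (R * R)) : open A -> open (P @` A).
Proof.
move=> oA; rewrite /open /= /quotient_open.
rewrite (_ : _ @^-1` _ = \bigcup_(mn : int * int)
    (fun x : R * R => (x.1 + mn.1%:~R, x.2 + mn.2%:~R)) @^-1` A).
  apply: bigcup_open => mn _; apply: open_comp => // x _.
  apply: (@cvg_pair _ _ _ _ (nbhs (x.1 + mn.1%:~R)) (nbhs (x.2 + mn.2%:~R))).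
    by apply: cvgD; [exact: cvg_fst|exact: cvg_cst].
  by apply: cvgD; [exact: cvg_snd|exact: cvg_cst].
apply/seteqP; split => x /=.
  move=> [y Ay /torus_projP[m [n yx]]]; exists (m, n) => //=.
  by rewrite -yx.
move=> [[m n] _ Ax]; exists (x.1 + m%:~R, x.2 + n%:~R) => //.
by apply/torus_projP; exists m, n.
Qed.

(** The projection stays a quotient map after taking the product with the line,
    because it is open; this is how homotopies on the torus are shown to be
    continuous. *)
Lemma prod_torus_continuous (Z : topologicalType) (f : R * T -> Z) :
  continuous (fun tx : R * (R * R) => f (tx.1, P tx.2)) -> continuous f.
Proof.
move=> cf [t p] W; rewrite -(repK p) => /(cf (t, rep p))[[A B] /= [At Bp] AB].
exists (A, P @` B^°) => /=.
  split => //; suff : open_nbhs (P (rep p)) (P @` B^°) by exact: (@open_nbhs_nbhs T).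
  split; first by apply: proj_open; exact: open_interior.
  by exists (rep p).
move=> [s q] [/= As [b Bb <-]].
by apply: (AB (s, b)); split => //; exact: interior_subset.
Qed.

Definition vshift (u : R -> R) (p : T) : T := P ((rep p).1, (rep p).2 + u (rep p).2).

Definition int_periodic (u : R -> R) := forall y (n : int), u (y + n%:~R) = u y.

Lemma vshift_proj u x : int_periodic u -> vshift u (P x) = P (x.1, x.2 + u x.2).
Proof.
move=> uD; rewrite /vshift; have [m [n ->]] := rep_proj x => /=; rewrite uD.
by apply/torus_projP; exists m, n => /=; rewrite addrAC.
Qed.

Lemma vshift_continuous u : int_periodic u -> continuous u -> continuous (vshift u).
Proof.
move=> uD cu; apply/torus_continuous.
rewrite (_ : _ \o _ = P \o (fun x => (x.1, x.2 + u x.2))); last first.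
  by apply/funext => x /=; rewrite vshift_proj.
move=> x; apply: continuous_comp; last exact: torus_proj_continuous.
apply: (@cvg_pair _ _ _ _ (nbhs x.1) (nbhs (x.2 + u x.2))); first exact: cvg_fst.
apply: cvgD; first exact: cvg_snd.
by apply: (@continuous_comp _ _ _ snd u); [exact: cvg_snd|exact: cu].
Qed.

(** Scaling the displacement down to zero is an isotopy to the identity. *)
Lemma vshift_homotopic u : int_periodic u -> continuous u -> homotopic R (vshift u) id.
Proof.
move=> uD cu; exists (fun tp => vshift (fun y => (1 - tp.1) * u y) tp.2); split.
- apply: continuous_subspaceT; apply: prod_torus_continuous.
  rewrite (_ : (fun _ => _) = P \o (fun tx : R * (R * R) =>
      (tx.2.1, tx.2.2 + (1 - tx.1) * u tx.2.2))); last first.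
    by apply/funext => -[t x] /=; rewrite vshift_proj// => y n; rewrite uD.
  move=> [t x]; apply: continuous_comp; last exact: torus_proj_continuous.
  have c2 : continuous (fun tx : R * (R * R) => tx.2.2).
    by move=> tx; apply: (@continuous_comp _ _ _ snd snd); exact: cvg_snd.
  apply: (@cvg_pair _ _ _ _ (nbhs x.1) (nbhs (x.2 + (1 - t) * u x.2))).
    exact: (cvg_comp _ _ (@cvg_snd _ _ (nbhs t) (nbhs x) _) cvg_fst).
  apply: cvgD; first exact: (c2 (t, x)).
  apply: cvgM; first by apply: cvgB; [exact: cvg_cst|exact: cvg_fst].
  exact: (cvg_comp _ _ (c2 (t, x)) (cu _)).
- by move=> p; rewrite /= /vshift subr0 mul1r.
- by move=> p; rewrite /= /vshift subrr mul0r addr0 -surjective_pairing repK.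
Qed.

Lemma vshift_cancel u v : int_periodic u -> int_periodic v ->
  (forall y, u y + v (y + u y) = 0) -> cancel (vshift u) (vshift v).
Proof.
move=> uD vD uv p; rewrite -(repK p) !vshift_proj//=.
by rewrite -addrA uv addr0 -surjective_pairing.
Qed.

End VerticalShift.

Section TangentShift.
Variable R : realType.
Local Notation P := (@torus_proj R).
Implicit Types (k y : R).

(** The angle (divided by pi) from the vector (cs, sn) to the vector
    (cs, sn + k cs), whose slope is tan (pi y) + k.  Written this way rather
    than as atan (tan + k) - atan tan, it is manifestly continuous and periodic
    across the poles. *)
Definition tan_shift k y : R := atan (k * cs y ^+ 2 / (1 + k * (sn y * cs y))) / pi.

Lemma snM_csDint y (n : int) : sn (y + n%:~R) * cs (y + n%:~R) = sn y * cs y.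
Proof.
rewrite snD csD sn_int !mulr0 subr0 addr0 mulrACA -expr2 cs2_int.
by rewrite mulr1.
Qed.

Lemma tan_shift_periodic k : int_periodic (tan_shift k).
Proof. by move=> y n; rewrite /tan_shift cs2Dint snM_csDint. Qed.

Lemma tan_shift_denom k y : k ^+ 2 = 1 -> 0 < 1 + k * (sn y * cs y).
Proof.
move=> k2; have := cs2sn2 y.
have : 0 <= (cs y + k * sn y) ^+ 2 by exact: sqr_ge0.
nra.
Qed.

Lemma tan_shift_continuous k : k ^+ 2 = 1 -> continuous (tan_shift k).
Proof.
move=> k2 y; rewrite /tan_shift.
have cc := continuous_is_derive (is_derive_cs y).
have cn := continuous_is_derive (is_derive_sn y).
have cc2 : {for y, continuous (fun y => cs y ^+ 2)}.
  exact: (cvgM cc cc).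
apply: cvgMl; apply: continuous_comp; last exact: continuous_atan.
apply: cvgM; first by apply: cvgMr; exact: cc2.
apply: cvgV; first by rewrite gt_eqF// tan_shift_denom.
apply: cvgD; first exact: cvg_cst.
by apply: cvgMr; apply: cvgM; [exact: cn|exact: cc].
Qed.

(** The rotated unit vector is a positive multiple r of (cs, sn + k cs). *)
Lemma tan_shift_trig k y : k ^+ 2 = 1 -> exists2 r, 0 < r &
  [/\ cs (y + tan_shift k y) = r * cs y, sn (y + tan_shift k y) = r * (sn y + k * cs y) &
      r ^+ 2 * (cs y ^+ 2 + (sn y + k * cs y) ^+ 2) = 1].
Proof.
move=> k2; set t := k * cs y ^+ 2 / (1 + k * (sn y * cs y)).
have d0 := tan_shift_denom y k2.
have dE : pi * tan_shift k y = atan t by rewrite /tan_shift mulrC divfK// gt_eqF// pi_gt0.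
have c0 : 0 < cos (atan t) by rewrite cos_gt0_pihalf// atan_gtNpi2 atan_ltpi2.
have sE : sin (atan t) = t * cos (atan t).
  by rewrite -{2}(atanK t) /tan divfK// gt_eqF.
have cE : cs (y + tan_shift k y) =
    cos (atan t) / (1 + k * (sn y * cs y)) * cs y.
  rewrite csD /cs -/(cs y) /sn -/(sn y) dE sE /t.
  have := gt_eqF d0 => /negbT d1.
  by field.
exists (cos (atan t) / (1 + k * (sn y * cs y))); first by rewrite divr_gt0.
have nE : sn (y + tan_shift k y) =
    cos (atan t) / (1 + k * (sn y * cs y)) * (sn y + k * cs y).
  rewrite snD /cs -/(cs y) /sn -/(sn y) dE sE /t.
  have := gt_eqF d0 => /negbT d1.
  have -> : sn y + k * cs y = sn y + k * cs y * (cs y ^+ 2 + sn y ^+ 2).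
    by rewrite cs2sn2 mulr1.
  by field.
split => //.
rewrite -[RHS](cs2sn2 (y + tan_shift k y)) cE nE; ring.
Qed.

(** The inverse of the shear with slope k is the shear with slope - k. *)
Lemma tan_shift_cancel k y : k ^+ 2 = 1 -> tan_shift k y + tan_shift (- k) (y + tan_shift k y) = 0.
Proof.
move=> k2; have [r r0 [cE nE rE]] := tan_shift_trig y k2.
rewrite [tan_shift (- k) _]/tan_shift cE nE.
have -> : - k * (r * cs y) ^+ 2 / (1 + - k * (r * (sn y + k * cs y) * (r * cs y))) =
    - (k * cs y ^+ 2 / (1 + k * (sn y * cs y))); last first.
  by rewrite atanN mulNr; exact: subrr.
have d0 := negbT (gt_eqF (tan_shift_denom y k2)).
have cs2 := cs2sn2 y.
have -> : 1 + - k * (r * (sn y + k * cs y) * (r * cs y)) =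
    r ^+ 2 * (1 + k * (sn y * cs y)).
  have -> : r ^+ 2 * (1 + k * (sn y * cs y)) =
      r ^+ 2 * ((cs y ^+ 2 + sn y ^+ 2) + k * (sn y * cs y)) by rewrite cs2.
  rewrite mulNr; apply/eqP; rewrite subr_eq; apply/eqP; rewrite -[LHS]rE; ring.
by field; rewrite d0 gt_eqF.
Qed.

Lemma tan_shift_tn y : cs y != 0 -> tn (y + tan_shift 1 y) = tn y + 1.
Proof.
move=> cy; have [r r0 [cE nE _]] := tan_shift_trig y (expr1n _ 2).
rewrite !tnE cE nE mul1r -mulf_div divff ?gt_eqF// mul1r mulrDl divff//.
Qed.

(** The profile is built from cs and from the 1-periodic function
    sin(pi t)^4 of t = tan (pi y), so the shift t |-> t + 1 multiplies it by a
    power of r and moves the bits one place. *)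
Lemma speed_tan_shift (e : int -> bool) y : exists2 l, 0 < l &
  speed (translate 1 e) y = l * speed e (y + tan_shift 1 y).
Proof.
have [r r0 [cE nE _]] := tan_shift_trig y (expr1n _ 2).
exists (r ^- 6); first by rewrite invr_gt0 exprn_gt0.
have [cy|cy] := eqVneq (cs y) 0.
  by rewrite /speed /damped cE cy mulr0 expr0n /= !(mul0r, mulr0).
rewrite /speed.
have -> : sgn e (y + tan_shift 1 y) = sgn (translate 1 e) y.
  by rewrite /sgn tan_shift_tn// /translate floorDrz ?floor1// rpred1.
have -> : damped (@ripple0 R) (y + tan_shift 1 y) = r ^+ 6 * damped (@ripple0 R) y.
  rewrite /damped /ripple0 cE /sntn tan_shift_tn// snD (sn_int _ 1) mulr0 addr0.
  have -> : (sn (tn y) * cs 1) ^+ 4 = sn (tn y) ^+ 4.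
    by rewrite exprMn (exprM (cs 1) 2 2) (cs2_int R 1) expr1n mulr1.
  ring.
by rewrite [RHS]mulrCA mulKf// expf_neq0// gt_eqF.
Qed.

(** The vertical shift by tan_shift 1 maps each horizontal orbit to a horizontal
    orbit, with a speed that differs by a positive constant factor; a linear
    change of time makes up for it. *)
Lemma translate_equivalent (e : int -> bool) :
  orbitally_equivalent (coded_field R (translate 1 e)) (coded_field R e).
Proof.
have one2 : (1 : R) ^+ 2 = 1 by rewrite expr1n.
have neg2 : (- 1 : R) ^+ 2 = 1 by rewrite sqrrN.
exists (vshift (tan_shift 1)); split.
- split; first exact: vshift_continuous (@tan_shift_periodic 1) (tan_shift_continuous one2).
  exists (vshift (tan_shift (- 1))); split.
  + exact: vshift_continuous (@tan_shift_periodic _) (tan_shift_continuous neg2).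
  + apply: vshift_cancel; [exact: tan_shift_periodic..|] => y; exact: tan_shift_cancel.
  + apply: vshift_cancel; [exact: tan_shift_periodic..|] => y.
    by have := tan_shift_cancel y neg2; rewrite opprK.
- exact: vshift_homotopic (@tan_shift_periodic 1) (tan_shift_continuous one2).
move=> c /integral_curveP[a [b ->]].
have [l l0 lE] := speed_tan_shift e b.
exists (fun t => P (a + speed e (b + tan_shift 1 b) * t, b + tan_shift 1 b)), (fun t => l * t).
split.
- by apply/integral_curveP; exists a, (b + tan_shift 1 b).
- by move=> s t st; rewrite ltr_pM2l.
- exists (fun t => l^-1 * t) => t; first by rewrite mulKf// gt_eqF.
  by rewrite mulVKf// gt_eqF.
- move=> t; rewrite vshift_proj; last exact: tan_shift_periodic.
  by rewrite /= lE; congr (P (_, _)); ring.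
Qed.

End TangentShift.

(** * Horizontal circles of the torus *)

Section Levels.
Variable R : realType.
Local Notation T := (torus R).
Local Notation P := (@torus_proj R).
Implicit Types (x y u : R) (z : R * R) (p q : T).

(** Up to an affine change of coordinates this is (cos 2 pi y, sin 2 pi y): a
    continuous function that determines y modulo 1. *)
Definition circ y : R * R := (cs y ^+ 2, sn y * cs y).

Lemma circDint y (n : int) : circ (y + n%:~R) = circ y.
Proof. by rewrite /circ cs2Dint snM_csDint. Qed.

Lemma snB_eq0 y y' : sn (y - y') = 0 -> exists n : int, y = y' + n%:~R.
Proof.
move=> /eqP; rewrite sn_eq0 => /intrP[n yn]; exists n.
by rewrite -yn addrC subrK.
Qed.

Lemma circ_inj y y' : circ y = circ y' -> exists n : int, y = y' + n%:~R.
Proof.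
move=> [c2 sc]; apply: snB_eq0; rewrite snD csN snN mulrN.
have [cy|cy] := eqVneq (cs y) 0.
  have cy' : cs y' = 0 by apply/eqP; rewrite -sqrf_eq0 -c2 cy expr0n.
  by rewrite cy cy' mulr0 mul0r subr0.
have cy' : cs y' != 0 by rewrite -sqrf_eq0 -c2 sqrf_eq0.
apply: (mulfI (mulf_neq0 cy cy')); rewrite mulr0.
have -> : cs y * cs y' * (sn y * cs y' - cs y * sn y') =
  sn y * cs y * cs y' ^+ 2 - sn y' * cs y' * cs y ^+ 2 by ring.
by rewrite c2 sc subrr.
Qed.

Lemma circ_continuous : continuous circ.
Proof.
move=> y; have cc := continuous_is_derive (is_derive_cs y).
have cn := continuous_is_derive (is_derive_sn y).
apply: (@cvg_pair _ _ _ _ (nbhs (cs y ^+ 2)) (nbhs (sn y * cs y))).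
  exact: (cvgM cc cc).
exact: (cvgM cn cc).
Qed.

(** Continuous circle-valued coordinates on the torus.  Two points lie on the
    same horizontal circle when they have the same ycirc. *)
Definition xcirc (p : T) : R * R := circ (rep p).1.
Definition ycirc (p : T) : R * R := circ (rep p).2.

Lemma xcircE z : xcirc (P z) = circ z.1.
Proof. by rewrite /xcirc; have [m [n ->]] := rep_proj z; rewrite circDint. Qed.

Lemma ycircE z : ycirc (P z) = circ z.2.
Proof. by rewrite /ycirc; have [m [n ->]] := rep_proj z; rewrite circDint. Qed.

Lemma xcirc_continuous : continuous xcirc.
Proof.
apply/torus_continuous; rewrite (_ : _ \o _ = circ \o fst).
  by move=> z; apply: continuous_comp; [exact: cvg_fst|exact: circ_continuous].
by apply/funext => z; exact: xcircE.
Qed.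

Lemma ycirc_continuous : continuous ycirc.
Proof.
apply/torus_continuous; rewrite (_ : _ \o _ = circ \o snd).
  by move=> z; apply: continuous_comp; [exact: cvg_snd|exact: circ_continuous].
by apply/funext => z; exact: ycircE.
Qed.

Lemma proj_Dint x y (m n : int) : P (x + m%:~R, y + n%:~R) = P (x, y).
Proof. by apply/torus_projP; exists m, n. Qed.

Lemma proj_ycirc z q : ycirc q = circ z.2 -> exists x, q = P (x, z.2).
Proof.
rewrite /ycirc => /circ_inj[n yn]; exists (rep q).1; rewrite -[LHS]repK.
by apply/torus_projP; exists 0, n; rewrite /= addr0 -yn -surjective_pairing.
Qed.

Lemma torus_eq p q : xcirc p = xcirc q -> ycirc p = ycirc q -> p = q.
Proof.
rewrite -(repK p) -(repK q) !xcircE !ycircE => /circ_inj[m pq1] /circ_inj[n pq2].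
apply/torus_projP; exists m, n.
by rewrite -pq1 -pq2 -surjective_pairing.
Qed.

Lemma proj_inj1 x x' y : P (x, y) = P (x', y) -> exists n : int, x = x' + n%:~R.
Proof. by move=> /(congr1 xcirc); rewrite !xcircE => /circ_inj. Qed.

(** The value of tan (pi y), expressed through ycirc so that it is clearly
    continuous off the polar circle. *)
Definition ytan (p : T) : R := (ycirc p).2 / (ycirc p).1.

Lemma ytanE z : ytan (P z) = tn z.2.
Proof.
rewrite /ytan ycircE /circ /= tnE; have [->|cz] := eqVneq (cs z.2) 0.
  by rewrite mulr0 invr0 mul0r mulr0.
by field.
Qed.

Lemma ytan_ycirc p q : (ycirc p).1 != 0 -> (ycirc q).1 != 0 -> ytan p = ytan q -> ycirc p = ycirc q.
Proof.
have tan_circ z : (ycirc (P z)).1 != 0 ->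
    ycirc (P z) = ((1 + ytan (P z) ^+ 2)^-1, ytan (P z) / (1 + ytan (P z) ^+ 2)).
  rewrite ytanE ycircE /= sqrf_eq0 => cz.
  by rewrite /tn -cos2_tan2// -/(cs z.2) invrK /circ -/(tn z.2) tnE; congr pair; field.
rewrite -(repK p) -(repK q) => /tan_circ pE /tan_circ qE pq.
by rewrite pE qE pq.
Qed.

Lemma stillDint y (n : int) : still (y + n%:~R) <-> still y.
Proof.
rewrite /still /sntn tnDint; split=> -[/eqP cy|]; [left|by right|left|by right].
  by apply/eqP; rewrite -sqrf_eq0 -(cs2Dint y n) sqrf_eq0.
by apply/eqP; rewrite -sqrf_eq0 (cs2Dint y n) sqrf_eq0.
Qed.

Definition stillT (p : T) := still (rep p).2.

Lemma stillTE z : stillT (P z) <-> still z.2.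
Proof. by rewrite /stillT; have [m [n ->]] := rep_proj z; exact: stillDint. Qed.

Lemma stillT_ytan p : (ycirc p).1 != 0 -> stillT p <-> ytan p \is a Num.int.
Proof.
rewrite -(repK p) stillTE ytanE ycircE /= sqrf_eq0 -sn_eq0 => cp.
split=> [[/eqP|/eqP]//|/eqP]; last by right.
by rewrite (negPf cp).
Qed.

Lemma speed_still e y : speed e y = 0 <-> still y.
Proof.
split=> [/eqP|/damped_still[y0 _ _]]; last by rewrite /speed y0 mulr0.
rewrite /speed mulf_eq0 -normr_eq0 norm_sgn oner_eq0 /damped /ripple0 /= => /eqP damped0.
have [|cy] := eqVneq (cs y) 0; [by left|right].
move: damped0; rewrite mulrA -[RHS](mulr0 (cs y ^+ 2 * cs y ^+ 4)).
move=> /(mulfI (mulf_neq0 (expf_neq0 2 cy) (expf_neq0 4 cy))) /eqP.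
by rewrite expf_eq0 => /andP[_ /eqP].
Qed.

(** If all heights near y were rest heights, tan (pi y) would be an integer on
    an interval, hence constant there, although tan is injective on short
    intervals. *)
Lemma moving_dense y (A : set R) : nbhs y A -> exists2 x, A x & ~ still x.
Proof.
have step y0 A0 : nbhs y0 A0 -> exists d : R, [/\ 0 < d, d < 1 & A0 (y0 + d)].
  move=> /nbhs_ballP[r /= r0 rA]; exists (Num.min (r / 2) (1 / 2)).
  have h0 : 0 < Num.min (r / 2) (1 / 2) by rewrite lt_min !divr_gt0.
  split => //; first by rewrite gt_min; apply/orP; right; lra.
  apply: rA; rewrite /ball /= opprD addrA subrr sub0r normrN gtr0_norm//.
  by rewrite gt_min; apply/orP; left; lra.
have sn_small (d : R) : 0 < d -> d < 1 -> sn d != 0.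
  move=> d0 d1; rewrite gt_eqF// /sn sin_gt0_pi// mulr_gt0 ?pi_gt0//=.
  by rewrite -[ltRHS]mulr1 ltr_pM2l// pi_gt0.
have near_ns y0 A0 : nbhs y0 A0 -> cs y0 != 0 -> exists2 x, A0 x & ~ still x.
  move=> yA cy; apply: contrapT => nex.
  have cc := continuous_is_derive (is_derive_cs y0).
  have ct := continuous_is_derive (is_derive_tn cy).
  have cy1 : \forall x \near y0, cs x != 0.
    exact: (cvgr_neq0 _ cc cy).
  have ty1 : \forall x \near y0, `|tn y0 - tn x| < 1.
    exact: (@cvgr_dist_lt _ _ _ _ _ _ _ ct 1 ltr01).
  have [d [d0 d1 [Ad [cd td]]]] := step y0 _ (filterI yA (filterI cy1 ty1)).
  have still_int x : A0 x -> cs x != 0 -> tn x \is a Num.int.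
    move=> Ax cx; rewrite -sn_eq0; apply/eqP.
    have [[/eqP|//]|nf] := pselect (still x); first by rewrite (negPf cx).
    by case: nex; exists x.
  have t0 := still_int y0 (nbhs_singleton yA) cy.
  have t1 := still_int _ Ad cd.
  have tE : tn y0 = tn (y0 + d).
    apply/eqP; rewrite -subr_eq0; move: td.
    have /intrP[k ->] : tn y0 - tn (y0 + d) \is a Num.int by rewrite rpredB.
    by rewrite -intr_norm ltrz1 intr_eq0 => ?; lia.
  have /eqP := sn_small d d0 d1; apply.
  have -> : d = y0 + d - y0 by rewrite addrC addKr.
  rewrite [LHS]snD csN snN mulrN.
  move: tE; rewrite !tnE => /eqP; rewrite eqr_div// => /eqP tE.
  by rewrite -tE mulrC subrr.
move=> yA; have [cy|cy] := eqVneq (cs y) 0; last exact: near_ns yA cy.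
have [d [d0 d1 Ad]] := step y _ (nbhs_interior yA).
apply: near_ns Ad _; rewrite csD cy mul0r sub0r oppr_eq0 mulf_neq0//.
  apply/eqP => sy; have := cs2sn2 y; rewrite cy sy expr0n addr0 => /eqP.
  by rewrite eq_sym oner_eq0.
exact: sn_small.
Qed.

End Levels.

(** * Homeomorphisms carrying orbits to orbits *)

Section OrbitMaps.
Variable R : realType.
Local Notation T := (torus R).
Local Notation P := (@torus_proj R).
Implicit Types (x y u : R) (z : R * R) (p q : T).

Lemma proj_neq x x' y : x < x' -> x' < x + 1 -> P (x', y) <> P (x, y).
Proof.
move=> xx' x'x /proj_inj1[n] nE; move: xx' x'x; rewrite nE.
by rewrite ltrDl ltrD2l -[1]/(1%:~R) ltr0z ltr_int; lia.
Qed.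

Variables (e e' : int -> bool) (H G : T -> T).
Hypothesis HK : cancel H G.
Hypothesis Horb : maps_oriented_orbits H (coded_field R e) (coded_field R e').

Lemma maps_orbit x y : exists x' y' (tau : R -> R),
  [/\ {homo tau : s t / s < t}, bijective tau &
    forall t, H (P (x + speed e y * t, y)) = P (x' + speed e' y' * tau t, y')].
Proof.
have /Horb[d [tau [/integral_curveP[x' [y' ->]] mono bij tauE]]] :
    integral_curve (coded_field R e) (fun t => P (x + speed e y * t, y)).
  by apply/integral_curveP; exists x, y.
by exists x', y', tau.
Qed.

(** The image of a rest point is a single point, but the change of time is onto:
    the orbit through that image is reduced to a point. *)
Lemma maps_still p : stillT p -> stillT (H p).
Proof.
rewrite -(repK p); move: (rep p) => z /stillTE/speed_still-/(_ e) z0.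
have [x' [y' [tau [_ [g _ gK] tauE]]]] := maps_orbit z.1 z.2.
have HE t : H (P z) = P (x' + speed e' y' * t, y').
  by rewrite -{1}(gK t) -tauE z0 mul0r addr0 -surjective_pairing.
rewrite (HE 0); apply/stillTE/(speed_still e'); apply/eqP; apply: contrapT => s0.
move/negP in s0.
have /esym := etrans (esym (HE 0)) (HE (2^-1 / speed e' y')).
rewrite mulr0 addr0 mulrC divfK//.
by apply: proj_neq; lra.
Qed.

(** The image of a horizontal circle of periodic points is all of another such
    circle.  The monotone reparametrization theta turns with the same sense
    exactly when the two speeds have the same sign. *)
Lemma maps_level y : ~ still y -> exists y' (theta : R -> R),
  [/\ ~ still y', forall r, exists x, theta x = r,
    forall x, H (P (x, y)) = P (theta x, y') &
    forall x x', x < x' -> 0 < speed e y * speed e' y' * (theta x' - theta x)].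
Proof.
move=> fy; set s := speed e y.
have s0 : s != 0 by apply/eqP => /speed_still.
have [x' [y' [tau [mono [g gK Kg] tauE]]]] := maps_orbit 0 y.
set s' := speed e' y' in tauE.
pose theta x := x' + s' * tau (x / s).
have HE x : H (P (x, y)) = P (theta x, y').
  by rewrite /theta -tauE -/s add0r mulrC divfK.
have s'0 : s' != 0.
  apply/eqP => s'0.
  have /(can_inj HK) : H (P (2^-1, y)) = H (P (0, y)).
    by rewrite !HE /theta s'0 !mul0r.
  by apply: proj_neq; lra.
exists y', theta; split => //.
- by move=> /(speed_still e') /eqP; apply/negP.
- move=> r; exists (s * g ((r - x') / s')).
  by rewrite /theta [s * _ / s]mulrC mulKf// Kg mulrC divfK// addrC subrK.
- move=> x1 x2 x12; have -> : s * s' * (theta x2 - theta x1) =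
    s' ^+ 2 * (s * (tau (x2 / s) - tau (x1 / s))) by rewrite /theta; ring.
  have s'2 : 0 < s' ^+ 2 by rewrite exprn_even_gt0.
  rewrite pmulr_rgt0//.
  have [sp|sn|/eqP] := ltgtP 0 s; last by rewrite eq_sym (negPf s0).
    by rewrite pmulr_rgt0// subr_gt0 mono// ltr_pM2r ?invr_gt0.
  by rewrite nmulr_rgt0// subr_lt0 mono// ltr_nM2r ?invr_lt0.
Qed.

Lemma maps_stillE p : stillT (H p) <-> stillT p.
Proof.
split; last exact: maps_still.
rewrite -(repK p); move: (rep p) => -[x y] Hf; apply/stillTE; apply: contrapT.
move=> /maps_level[y' [theta [fy' _ HE _]]].
by move: Hf; rewrite HE => /stillTE.
Qed.

End OrbitMaps.

Section LevelMaps.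
Variable R : realType.
Local Notation T := (torus R).
Local Notation P := (@torus_proj R).
Implicit Types (x y u : R) (z : R * R) (p q : T) (H G : T -> T).

(** What is needed from H and from its inverse, in a form that makes the two
    play the same role; the hypothesis on orbits itself is not symmetric. *)
Definition level_map H := [/\ continuous H,
  forall p, stillT (H p) <-> stillT p &
  forall p q, ~ stillT p -> ycirc p = ycirc q -> ycirc (H p) = ycirc (H q)].

Lemma orbit_map_level (e e' : int -> bool) H G : continuous H -> cancel H G ->
  maps_oriented_orbits H (coded_field R e) (coded_field R e') -> level_map H.
Proof.
move=> cH HK Horb; split => //; first exact: maps_stillE HK Horb.
move=> p q; rewrite -(repK p); move: (rep p) => {p} [x y] fp.
rewrite ycircE => /esym /proj_ycirc[x' ->].
have fy : ~ still y by move=> fy; apply: fp; apply/stillTE.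
have [y' [theta [_ _ HE _]]] := maps_level HK Horb fy.
by rewrite !HE !ycircE.
Qed.

(** The image of a horizontal circle of periodic points is a full circle, so its
    preimage under H is a single circle as well. *)
Lemma inverse_level (e e' : int -> bool) H G : continuous G -> cancel H G -> cancel G H ->
  maps_oriented_orbits H (coded_field R e) (coded_field R e') -> level_map G.
Proof.
move=> cG HK GK Horb; have fE := maps_stillE HK Horb.
have fG p : stillT (G p) <-> stillT p by rewrite -{2}(GK p) fE.
split => // p q fp pq.
have [x [y pE]] : exists x y, G p = P (x, y).
  by exists (rep (G p)).1, (rep (G p)).2; rewrite -surjective_pairing repK.
have fy : ~ still y by move=> fy; apply: fp; apply/fG; rewrite pE; apply/stillTE.
have [y' [theta [_ surj HE _]]] := maps_level HK Horb fy.
have pE' : p = P (theta x, y') by rewrite -HE -pE GK.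
have [x2] : exists x2, q = P (x2, y') by apply: (@proj_ycirc _ (0, y')); rewrite -pq pE' ycircE.
have [x3 <-] := surj x2; rewrite -HE => ->.
by rewrite HK pE !ycircE.
Qed.

Lemma torus_line_continuous (Z : topologicalType) (H : T -> Z) x :
  continuous H -> continuous (fun y => H (P (x, y))).
Proof.
move=> cH y; apply: (@continuous_comp _ _ _ (fun y => P (x, y)) H); last exact: cH.
apply: (@continuous_comp _ _ _ (fun y => (x, y)) P); last exact: torus_proj_continuous.
by apply: (@cvg_pair _ _ _ _ (nbhs x) (nbhs y)); [exact: cvg_cst|exact: cvg_id].
Qed.

Lemma eq_dense (f g : R -> R * R) : continuous f -> continuous g ->
  (forall y, ~ still y -> f y = g y) -> f =1 g.
Proof.
move=> cf cg fg y; apply: contrapT => /eqP; rewrite -subr_eq0 => fgy.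
have /(cvgr_neq0 _)/(_ fgy)/moving_dense[x] : f t - g t @[t --> y] --> f y - g y.
  by apply: cvgB; [exact: cf|exact: cg].
by move=> /= /eqP ne /fg fgx; apply: ne; rewrite fgx subrr.
Qed.

(** Periodic points are dense, so the property extends to the rest circles by
    continuity. *)
Lemma level_map_ycirc H p q : level_map H -> ycirc p = ycirc q -> ycirc (H p) = ycirc (H q).
Proof.
move=> [cH _ Hlev]; rewrite -(repK p); move: (rep p) => {p} [x y].
rewrite ycircE => /esym /proj_ycirc[x' ->] /=.
apply: (@eq_dense (fun y => ycirc (H (P (x, y)))) (fun y => ycirc (H (P (x', y))))).
- by apply: (torus_line_continuous (H := @ycirc R \o H)) => z;
    apply: continuous_comp; [exact: cH|exact: ycirc_continuous].
- by apply: (torus_line_continuous (H := @ycirc R \o H)) => z;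
    apply: continuous_comp; [exact: cH|exact: ycirc_continuous].
- by move=> t ft; apply: Hlev; [rewrite stillTE|rewrite !ycircE].
Qed.

Lemma level_map_inj H G p q : level_map G -> cancel H G ->
  ycirc (H p) = ycirc (H q) -> ycirc p = ycirc q.
Proof. by move=> lG HK /(level_map_ycirc lG); rewrite !HK. Qed.

(** A parametrization of the heights other than the pole by t = tan (pi y). *)
Definition height u : R := atan u / pi.

Lemma tn_height u : tn (height u) = u.
Proof. by rewrite /tn /height mulrC divfK ?atanK// gt_eqF// pi_gt0. Qed.

Lemma cs_height u : cs (height u) != 0.
Proof.
rewrite /cs /height mulrC divfK ?gt_eqF ?pi_gt0//.
by rewrite cos_gt0_pihalf// atan_gtNpi2 atan_ltpi2.
Qed.

Lemma height_continuous : continuous height.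
Proof. by move=> u; apply: cvgMl; exact: continuous_atan. Qed.

Lemma still_height u : still (height u) <-> u \is a Num.int.
Proof.
rewrite /still -sn_eq0 /sntn tn_height; split=> [[/eqP|->//]|/eqP]; last by right.
by rewrite (negPf (cs_height u)).
Qed.

Lemma cvg_height : height u @[u --> +oo] --> (2^-1 : R).
Proof.
have -> : 2^-1 = pi / 2 / pi :> R by rewrite mulrAC divff ?mul1r// gt_eqF// pi_gt0.
by apply: cvgMl; exact: cvgy_atan.
Qed.

Lemma pole_half y : cs y = 0 -> exists n : int, y = 2^-1 + n%:~R.
Proof.
move=> cy; apply: snB_eq0; rewrite snD csN snN cy mul0r addr0.
by rewrite /cs cos_pihalf mulr0.
Qed.

Lemma ytan_continuous p : (ycirc p).1 != 0 -> {for p, continuous (@ytan R)}.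
Proof.
move=> p0; apply: (@continuous_comp _ _ _ (@ycirc R) (fun z => z.2 / z.1)).
  exact: ycirc_continuous.
by apply: cvgM; [exact: cvg_snd|apply: cvgV => //; exact: cvg_fst].
Qed.

(** The rest circles accumulate at the polar circle and at no other circle.  If
    the polar circle went to the rest circle tan = m, then for large n the
    circle tan = n would go to a rest circle close to it, hence to that same
    circle, for two different values of n. *)
Lemma level_map_pole H G p : level_map H -> level_map G -> cancel H G ->
  (ycirc p).1 = 0 -> (ycirc (H p)).1 = 0.
Proof.
move=> lH lG HK; rewrite -(repK p); move: (rep p) => {p} [x y].
rewrite ycircE /= => /eqP; rewrite sqrf_eq0 => /eqP /pole_half[n ->].
rewrite -[x]addr0 (proj_Dint x _ 0 n) => {y n}.
apply: contrapT => /eqP; set q := H _ => q0.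
have [cH Hf _] := lH.
have fq : stillT q.
  by apply/Hf/stillTE; left; rewrite /= /cs cos_pihalf.
have /intrP[m mE] := (stillT_ytan q0).1 fq.
(* q is the image of the point of the polar circle reached as t -> +oo *)
have cvq : H (P (x, height u)) @[u --> +oo] --> q.
  exact: (cvg_comp _ _ cvg_height (@torus_line_continuous T H x cH 2^-1)).
have near_ns : \forall u \near +oo, (ycirc (H (P (x, height u)))).1 != 0.
  apply: (cvgr_neq0 _ _ q0).
  exact: (cvg_comp _ _ cvq (cvg_comp _ _ (@ycirc_continuous R q)
    (@cvg_fst _ _ (nbhs (ycirc q).1) (nbhs (ycirc q).2) _))).
have near_tl : \forall u \near +oo, `|m%:~R - ytan (H (P (x, height u)))| < 1.
  have := cvg_comp _ _ cvq (ytan_continuous q0); rewrite mE => c.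
  exact: (@cvgr_dist_lt _ _ _ _ _ _ _ c 1 ltr01).
(* rest circles near q have an integer value of tan close to m, hence m *)
have [M [_ MP]] := filterI near_ns near_tl.
have tl_nat (k : nat) : M < k%:R -> (ycirc (H (P (x, height k%:R)))).1 != 0 /\
    ytan (H (P (x, height k%:R))) = m%:~R.
  move=> /MP[ns tlm]; split => //.
  have : ytan (H (P (x, height k%:R))) \is a Num.int.
    by apply/(stillT_ytan ns)/Hf/stillTE/still_height; rewrite natr_int.
  move: tlm => /[swap] /intrP[j ->]; rewrite -intrB -intr_norm.
  by rewrite -[1]/(1%:~R) ltr_int => ?; congr (_%:~R); lia.
have [k kM] : exists k : nat, M < k%:R by exists (Num.truncn M).+1; exact: truncnS_gt.
have [ns1 tl1] := tl_nat k kM.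
have [|ns2 tl2] := tl_nat k.+1; first by rewrite (lt_trans kM)// ltr_nat.
have /(level_map_inj lG HK) : ycirc (H (P (x, height k%:R))) = ycirc (H (P (x, height k.+1%:R))).
  by apply: ytan_ycirc => //; rewrite tl1 tl2.
move=> levk; have := congr1 (fun l : R * R => l.2 / l.1) levk.
rewrite -!/(ytan _) !ytanE /= !tn_height => /eqP.
by rewrite eqr_nat => /eqP; lia.
Qed.

End LevelMaps.

(** * Rigidity *)

Section IntegerMaps.
Variable R : realType.

Lemma int_const (A : Type) (h : int -> A) : (forall n, h (n + 1) = h n) ->
  forall n, h n = h 0.
Proof.
move=> hS; elim/int_rect => [//|n IH|n IH].
  by rewrite -IH -[RHS]hS; congr h; lia.
by rewrite -IH -[LHS]hS; congr h; lia.
Qed.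

(** By the intermediate value theorem an increasing map skips no integer, so it
    acts on the integers as a translation. *)
Lemma incr_int_map (F : R -> R) : continuous F ->
  {mono F : u v / u <= v} -> (forall u, F u \is a Num.int <-> u \is a Num.int) ->
  exists k : int, forall n : int, Num.floor (F (n%:~R + 2^-1)) = k + n.
Proof.
move=> cF Fmono Fint; have Flt := leW_mono Fmono.
have /choice[f fE] : forall n : int, exists m : int, F n%:~R = m%:~R.
  by move=> n; apply/intrP/Fint/intr_int.
have fS n : f (n + 1) = f n + 1.
  have lt1 : f n < f (n + 1) by rewrite -(ltr_int R) -!fE Flt ltr_int; lia.
  apply/eqP; rewrite eq_le; apply/andP; split; last by lia.
  rewrite leNgt; apply/negP => lt2.
  have [|||c] := @IVT R F n%:~R (n + 1)%:~R (f n + 1)%:~R.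
  - by rewrite ler_int; lia.
  - exact: continuous_subspaceT.
  - rewrite !fE; apply/andP; split; [rewrite ge_min|rewrite le_max]; apply/orP.
      by left; rewrite ler_int; lia.
    by right; rewrite ler_int; lia.
  move=> _ Fc; have /intrP[j cj] : c \is a Num.int by apply/Fint; rewrite Fc intr_int.
  move: Fc lt2; rewrite cj fE => /eqP; rewrite eqr_int => /eqP fj lt2.
  have : F n%:~R < F j%:~R < F (n + 1)%:~R by rewrite !fE !ltr_int fj; lia.
  by rewrite !Flt !ltr_int; lia.
have fk n : f n = f 0 + n.
  have := @int_const _ (fun n => f n - n) _ n; rewrite subr0 => <-; first by lia.
  by move=> m; rewrite fS; lia.
exists (f 0) => n; apply: floor_def; rewrite -fk -fS -!fE; apply/andP; split.
  by rewrite Fmono lerDl invr_ge0.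
by rewrite Flt intrD ltrD2l invf_lt1 ?ltr1n.
Qed.

Lemma inj_int_map (F : R -> R) : continuous F -> injective F ->
  (forall u, F u \is a Num.int <-> u \is a Num.int) ->
  exists (r : bool) (k : int), forall n : int,
    Num.floor (F (n%:~R + 2^-1)) = if r then k - n else k + n.
Proof.
move=> cF injF Fint.
have [] := @itv_continuous_inj_mono R F `]-oo, +oo[.
- exact: continuous_subspaceT.
- by move=> u v _ _; exact: injF.
- move=> mono; have [|k kE] := @incr_int_map F cF _ Fint; last by exists false, k.
  by apply: le_mono => u v uv; apply: mono; rewrite ?in_itv.
move=> nmono; have cN : continuous (fun u => F (- u)).
  move=> u; apply: (@continuous_comp _ _ _ -%R F); [exact: opp_continuous|exact: cF].
have [||k kE] := @incr_int_map (fun u => F (- u)) cN.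
- apply: le_mono => u v uv; apply: nmono; rewrite ?in_itv//.
  by rewrite ltrN2.
- by move=> u; rewrite Fint rpredN.
exists true, (k - 1) => n.
have := kE (- n - 1); rewrite !intrD !intrN mulr1z.
rewrite (_ : - (- n%:~R - 1 + 2^-1) = n%:~R + 2^-1 :> R); last by field.
by move=> ->; lia.
Qed.

End IntegerMaps.

Section Rigidity.
Variable R : realType.
Local Notation T := (torus R).
Local Notation P := (@torus_proj R).
Implicit Types (x y u : R) (z : R * R) (p q r : T) (H G : T -> T).

(** The signed area (up to a factor) of the triangle formed by the first
    coordinates of three points, seen on a circle: its sign is the cyclic order
    of the points.  It is a polynomial in continuous functions on the torus. *)
Definition orient p q r : R :=
  ((xcirc q).1 - (xcirc p).1) * ((xcirc r).2 - (xcirc p).2) -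
  ((xcirc r).1 - (xcirc p).1) * ((xcirc q).2 - (xcirc p).2).

(** Each half-angle sine vanishes exactly when two of the three points
    coincide. *)
Lemma orientE z1 z2 z3 : orient (P z1) (P z2) (P z3) =
  sn (z2.1 - z1.1) * sn (z3.1 - z1.1) * sn (z3.1 - z2.1).
Proof.
have c2B x x' : cs x ^+ 2 - cs x' ^+ 2 = - (sn (x - x') * sn (x + x')).
  rewrite !snD csN snN; have := cs2sn2 x; have := cs2sn2 x'.
  move=> /eqP; rewrite eq_sym addrC -subr_eq => /eqP h'.
  move=> /eqP; rewrite eq_sym addrC -subr_eq => /eqP h.
  have -> : - ((sn x * cs x' + cs x * - sn x') * (sn x * cs x' + cs x * sn x')) =
    - (sn x ^+ 2 * cs x' ^+ 2 - cs x ^+ 2 * sn x' ^+ 2) by ring.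
  by rewrite -h -h'; ring.
have scB x x' : sn x * cs x - sn x' * cs x' = sn (x - x') * cs (x + x').
  rewrite snD csD csN snN.
  have -> : (sn x * cs x' + cs x * - sn x') * (cs x * cs x' - sn x * sn x') =
    sn x * cs x * (cs x' ^+ 2 + sn x' ^+ 2) - sn x' * cs x' * (cs x ^+ 2 + sn x ^+ 2) by ring.
  by rewrite !cs2sn2 !mulr1.
rewrite /orient !xcircE /circ /= !c2B !scB.
have -> : sn (z3.1 - z2.1) = sn ((z3.1 + z1.1) - (z2.1 + z1.1)) by congr sn; ring.
rewrite [sn (z3.1 + z1.1 - _)]snD csN snN; ring.
Qed.

(** Distinct points of a horizontal circle have images on one circle, which are
    again distinct by injectivity. *)
Lemma orient_neq0 H G y : level_map H -> cancel H G ->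
  orient (H (P (0, y))) (H (P (3^-1, y))) (H (P (2 / 3, y))) != 0.
Proof.
move=> lH HK.
have neq x x' : x < x' -> x' < x + 1 ->
    sn ((rep (H (P (x', y)))).1 - (rep (H (P (x, y)))).1) != 0.
  move=> xx' x'x; apply/eqP => /snB_eq0[n xE].
  apply: (@proj_neq R x x' y xx' x'x); apply: (can_inj HK); apply: torus_eq.
    by rewrite /xcirc xE circDint.
  by apply: level_map_ycirc lH _; rewrite !ycircE.
rewrite -(repK (H (P (0, y)))) -(repK (H (P (3^-1, y)))) -(repK (H (P (2 / 3, y)))).
by rewrite orientE !mulf_neq0// neq//; lra.
Qed.

Lemma orient_continuous H : continuous H -> continuous (fun y =>
  orient (H (P (0, y))) (H (P (3^-1, y))) (H (P (2 / 3, y)))).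
Proof.
move=> cH.
have ca x : continuous (fun y => xcirc (H (P (x, y)))).
  apply: (@torus_line_continuous R _ (@xcirc R \o H)) => p.
  by apply: continuous_comp; [exact: cH|exact: xcirc_continuous].
have c1 x : continuous (fun y => (xcirc (H (P (x, y)))).1).
  by move=> y; apply: (@continuous_comp _ _ _ _ fst) (ca x y) _; exact: cvg_fst.
have c2 x : continuous (fun y => (xcirc (H (P (x, y)))).2).
  by move=> y; apply: (@continuous_comp _ _ _ _ snd) (ca x y) _; exact: cvg_snd.
move=> y; rewrite /orient; apply: cvgB; apply: cvgM; apply: cvgB;
  first [exact: c1|exact: c2].
Qed.

Lemma continuous_sign (f : R -> R) : continuous f -> (forall y, f y != 0) ->
  forall y y', 0 < f y -> 0 < f y'.
Proof.
move=> cf f0 y y' fy; rewrite ltNge; apply/negP => fy'.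
have [|||c _ fc] := @IVT R f (Num.min y y') (Num.max y y') 0.
- by rewrite ge_min le_max lexx.
- exact: continuous_subspaceT.
- by case: (leP y y') => _; rewrite ge_min le_max fy' (ltW fy) ?orbT.
by have := f0 c; rewrite fc eqxx.
Qed.

(** An increasing lift of a bijection of circles advances by less than one full
    turn on an interval of length less than one. *)
Lemma orient_incr (theta : R -> R) y' : (forall t, exists x, theta x = t) ->
  (forall x x', x < x' -> theta x < theta x') ->
  (forall x x', P (theta x, y') = P (theta x', y') -> exists n : int, x = x' + n%:~R) ->
  forall x x', x < x' -> x' < x + 1 -> 0 < sn (theta x' - theta x).
Proof.
move=> surj incr inj x x' xx' x'x.
(* x1 is the first parameter at which theta has made a full turn from x *)
have [x1 x1E] := surj (theta x + 1).
have x01 : x < x1.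
  have mono : {mono theta : s t / s <= t} by apply: le_mono.
  by rewrite -(leW_mono mono) x1E ltrDl.
have x1' : x' < x1.
  rewrite ltNge; apply/negP => x1x'.
  have [n nE] : exists n : int, x1 = x + n%:~R.
    by apply: inj; rewrite x1E -[1]/(1%:~R) -[y' in LHS]addr0 (proj_Dint _ _ 1 0).
  move: x01 x1x'; rewrite nE ltrDl ltr0z => n0 nx'.
  have : n%:~R < 1%:~R :> R by rewrite mulr1z; lra.
  by rewrite ltr_int; lia.
have d0 : 0 < theta x' - theta x by rewrite subr_gt0 incr.
have d1 : theta x' - theta x < 1 by have := incr _ _ x1'; rewrite x1E; lra.
rewrite /sn sin_gt0_pi// mulr_gt0 ?pi_gt0//=.
by rewrite -[ltRHS]mulr1 ltr_pM2l// pi_gt0.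
Qed.

(** The cyclic order of the images of three points of a periodic orbit tells
    whether the rotation sense is kept. *)
Lemma maps_orient (e e' : int -> bool) H G y : cancel H G ->
  maps_oriented_orbits H (coded_field R e) (coded_field R e') -> ~ still y ->
  exists x' y', H (P (0, y)) = P (x', y') /\
    0 < speed e y * speed e' y' *
      orient (H (P (0, y))) (H (P (3^-1, y))) (H (P (2 / 3, y))).
Proof.
move=> HK Horb fy; have [y' [theta [_ surj HE mono]]] := maps_level HK Horb fy.
exists (theta 0), y'; split=> //; rewrite !HE orientE /=.
set s := speed e y * speed e' y' in mono *; clearbody s.
have inj x x' : P (theta x, y') = P (theta x', y') -> exists n : int, x = x' + n%:~R.
  by rewrite -!HE => /(can_inj HK)/proj_inj1.
have [sp|sneg|s0] := ltgtP 0 s; last 1 first.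
- by have := mono 0 1 ltr01; rewrite -s0 mul0r ltxx.
- have incr x x' : x < x' -> theta x < theta x'.
    by move=> /mono; rewrite pmulr_rgt0// subr_gt0.
  by rewrite !mulr_gt0//; apply: (orient_incr surj incr inj); lra.
have incr x x' : x < x' -> - theta x < - theta x'.
  by move=> /mono; rewrite nmulr_rgt0// subr_lt0 ltrN2.
have surjN t : exists x, - theta x = t.
  by have [x xE] := surj (- t); exists x; rewrite xE opprK.
have injN x x' : P (- theta x, - y') = P (- theta x', - y') -> exists n : int, x = x' + n%:~R.
  move=> /proj_inj1[m mE]; apply: inj.
  by rewrite -[theta x]opprK mE opprD opprK -intrN -[y' in LHS]addr0 (proj_Dint _ _ _ 0).
have snlt0 x x' : x < x' -> x' < x + 1 -> sn (theta x' - theta x) < 0.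
  move=> xx' x'x; have := orient_incr surjN incr injN xx' x'x.
  by rewrite -opprD snN oppr_gt0.
rewrite nmulr_rgt0// pmulr_rlt0; first by apply: snlt0; lra.
by rewrite nmulr_rgt0 ?snlt0//; lra.
Qed.

Lemma damped_ge0 y : 0 <= damped (@ripple0 R) y.
Proof. by rewrite /damped /ripple0; apply: mulr_ge0; [|apply: mulr_ge0]; apply: exprn_even_ge0. Qed.

(** The cyclic order of the images of three points at height y never
    degenerates, so its sign s is the same for all y; comparing it with the
    senses of rotation on the annulus n and on its image relates the bits of e
    and e'. *)
Theorem rigidity (e e' : int -> bool) :
  orbitally_equivalent (coded_field R e) (coded_field R e') ->
  exists (s r : bool) (k : int), forall n,
    e n = s (+) e' (if r then k - n else k + n).
Proof.
move=> [H [[cH [G [cG HK GK]]] _ Horb]].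
have lH := orbit_map_level cH HK Horb.
have lG := inverse_level cG HK GK Horb.
pose F u := ytan (H (P (0, height u))).
have ns u : (ycirc (H (P (0, height u)))).1 != 0.
  apply/eqP => /(level_map_pole lG lH GK); rewrite HK ycircE => /eqP.
  by rewrite sqrf_eq0 (negPf (cs_height u)).
have cF : continuous F.
  move=> u; apply: (@continuous_comp _ _ _ (fun u => H (P (0, height u))) (@ytan R)).
    apply: (@continuous_comp _ _ _ (@height R) (fun y => H (P (0, y)))).
      exact: height_continuous.
    exact: torus_line_continuous.
  exact: ytan_continuous.
have injF : injective F.
  move=> u u' /(ytan_ycirc (ns u) (ns u'))/(level_map_inj lG HK) levE'.
  have := congr1 (fun l : R * R => l.2 / l.1) levE'.
  by rewrite -!/(ytan _) !ytanE /= !tn_height.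
have Fint u : F u \is a Num.int <-> u \is a Num.int.
  have [_ fH _] := lH.
  by rewrite -(stillT_ytan (ns u)) fH stillTE still_height.
have [r [k rk]] := inj_int_map cF injF Fint.
pose o y := orient (H (P (0, y))) (H (P (3^-1, y))) (H (P (2 / 3, y))).
have o0 y : o y != 0 by exact: orient_neq0 lH HK.
have co : continuous o by exact: orient_continuous.
exists (o 0 < 0), r, k => n; rewrite -rk.
(* test the annulus n on its middle height *)
set u := n%:~R + 2^-1.
have fu : ~ still (height u).
  rewrite still_height /u => ui.
  have : (2^-1 : R) \is a Num.int by rewrite -(addKr n%:~R 2^-1) rpredD// rpredN intr_int.
  move=> /intrP[m mE].
  have m0 : (0 : R) < m%:~R by rewrite -mE; lra.
  have m1 : m%:~R < (1%:~R : R) by rewrite mulr1z -mE; lra.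
  by move: m0 m1; rewrite ltr0z ltr_int; lia.
have [x' [y' [HE]]] := maps_orient HK Horb fu.
rewrite -/(o _) /speed mulrACA [_ * o _]mulrAC.
have : 0 <= damped (@ripple0 R) (height u) * damped (@ripple0 R) y'.
  by rewrite mulr_ge0// damped_ge0.
rewrite le_eqVlt => /orP[/eqP P0|P0]; first by rewrite -P0 mulr0 ltxx.
rewrite pmulr_lgt0//.
have -> : sgn e (height u) = (-1) ^+ e n.
  rewrite /sgn tn_height; congr (_ ^+ e _); apply: floor_def.
  by rewrite /u lerDl invr_ge0 ler0n intrD ltrD2l invf_lt1 ?ltr1n.
have -> : sgn e' y' = (-1) ^+ e' (Num.floor (F u)).
  by rewrite /sgn /F HE ytanE.
have oE : (o (height u) < 0) = (o 0 < 0).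
  apply/idP/idP; apply: contraTT; rewrite -!leNgt !le_eqVlt => /orP[/eqP oz|].
  - by have := o0 0; rewrite -oz eqxx.
  - by move=> /(continuous_sign co o0) ->; rewrite orbT.
  - by have := o0 (height u); rewrite -oz eqxx.
  - by move=> /(continuous_sign co o0) ->; rewrite orbT.
rewrite -oE -signr_addb => {oE}.
case: (ltP (o (height u)) 0) => [on|op]; case: (e n); case: (e' _) => //=;
  rewrite ?(expr0, expr1); lra.
Qed.

End Rigidity.

(** * Absence of a complete Borel invariant *)

Theorem theorem2 (R : realType) :
  ~ exists (Y : topologicalType) (g : vfield R -> Y),
      [/\ polish R Y, borel_function g &
          forall v w : vfield R, orbitally_equivalent v w <-> g v = g w].
Proof.
move=> [Y [g [Ypolish gborel gE]]].
have [||N mN Nconst] := @generic_constant R Y (g \o coded_field R) Ypolish.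
- move=> U oU; rewrite comp_preimage.
  exact: decided_borel (@coded_field_continuous R) (gborel U oU).
- by move=> a; apply/gE; exact: translate_equivalent.
have [a _ aN] := @baire N (fun=> true) 0 mN.
(* the countably many codes whose field can be equivalent to that of a *)
pose t (i : bool * bool * int) (n : int) : bool :=
  i.1.1 (+) a (if i.1.2 then i.2 - n else i.2 + n)%R.
have [|b _ /not_orP[bN bt]] := @baire (N `|` \bigcup_i [set t i])%classic (fun=> true) 0.
  by apply: meagerU mN _; apply: meager_bigcup => i; exact: meager1.
have /gE/rigidity[s [r [k bE]]] : g (coded_field R b) = g (coded_field R a) by exact: Nconst.
by apply: bt; exists (s, r, k) => //; apply/funext => n; rewrite bE.
Qed.
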